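(* For ${\rm APP}=\{{\rm APP}_d\}_{d\in\mathbb N}$ in the average case setting: (i) with the absolute error criterion, ${\rm APP}$ is EXP-PT for $\Lambda^{\rm all}$ iff it is EXP-PT for $\Lambda^{\rm std}$, and ${\rm APP}$ is EXP-SPT for $\Lambda^{\rm all}$ iff it is EXP-SPT for $\Lambda^{\rm std}$; (ii) for $\star\in\{{\rm ABS},{\rm NOR}\}$, if ${\rm APP}$ is EXP-SPT for $\Lambda^{\rm all}$ with error criterion $\star$, then it is EXP-SPT for $\Lambda^{\rm std}$ with criterion $\star$ and ${\rm EXP}\text{-}p^{\star}(\Lambda^{\rm all})={\rm EXP}\text{-}p^{\star}(\Lambda^{\rm std})$.
   Context: Setting (average case approximation). For each $d\in\mathbb N$: $D_d\subset\mathbb R^d$ is a Borel set of positive Lebesgue measure, $\rho_d$ is a probability density on $D_d$, and $G_d=L_2(D_d,\rho_d(x)\,dx)$. $F_d$ is a separable Banach space of real-valued functions on $D_d$, continuously embedded in $G_d$, such that every point evaluation $f\mapsto f(x)$, $x\in D_d$, is a continuous linear functional on $F_d$; $F_d$ carries a zero-mean Gaussian measure $\mu_d$. ${\rm APP}_d:F_d\to G_d$, ${\rm APP}_d f=f$. $\Lambda^{\rm all}$ is the class of all continuous linear functionals on $F_d$, $\Lambda^{\rm std}$ the class of point evaluations. For $\Lambda\in\{\Lambda^{\rm all},\Lambda^{\rm std}\}$, an algorithm is $A_{n,d}f=\phi_{n,d}(L_1(f),\dots,L_n(f))$ with $L_i\in\Lambda$ and $\phi_{n,d}:\mathbb R^n\to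 G_d$ measurable; its average case error is $e^{\rm avg}(A_{n,d})=\big(\int_{F_d}\|f-A_{n,d}f\|_{G_d}^2\,\mu_d(df)\big)^{1/2}$, and $e^{\rm avg}(n,d;\Lambda)$ is the infimum of $e^{\rm avg}(A_{n,d})$ over all such algorithms using $n$ functionals from $\Lambda$ (for $n=0$, $A_{0,d}=0$). Set $\Gamma_d=(e^{\rm avg}(0,d;\Lambda))^2$ (same for both classes). Information complexity: $n^{\star}(\varepsilon,d;\Lambda)=\min\{n\ge0:\ e^{\rm avg}(n,d;\Lambda)\le\varepsilon\,{\rm CRI}_d\}$, with ${\rm CRI}_d=1$ for $\star={\rm ABS}$ and ${\rm CRI}_d=\sqrt{\Gamma_d}$ for $\star={\rm NOR}$. EXP-PT for $\Lambda$ (criterion $\star$): there exist $C>0$, $p,q\ge0$ with $n^{\star}(\varepsilon,d;\Lambda)\le Cd^q(1+\ln\varepsilon^{-1})^p$ for all $d\in\mathbb N$, $\varepsilon\in(0,1)$. EXP-SPT: the same with $q=0$; the exponent ${\rm EXP}\text{-}p^{\star}(\Lambda)$ is the infimum of all $p$ for which $n^{\star}(\varepsilon,d;\Lambda)\le C(1+\ln\varepsilon^{-1})^p$ holds for all $d,\varepsilon$ with some $C$. *)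

(* Defs.v *)
From HB Require Import structures.
From mathcomp Require Import all_boot all_order all_algebra.
From mathcomp Require Import all_classical all_reals all_analysis.

Set Implicit Arguments.
Unset Strict Implicit.
Unset Printing Implicit Defensive.

Import Order.TTheory GRing.Theory Num.Theory.
Import numFieldNormedType.Exports.
Local Open Scope classical_set_scope.
Local Open Scope ring_scope.

(** * Average case L2-approximation: setting, errors, information complexity,
      EXP tractability.  R^d is modelled by [d.-tuple R] with its product
      (Borel) sigma-algebra from MathComp-Analysis. *)

Inductive info_class := Lall | Lstd.
Inductive err_crit := ABS | NOR.

Section Level.
Context {R : realType}.

(** [lam] is d-dimensional Lebesgue measure: the (unique) measure on the Borel
    sets of R^d giving every half-open box its volume. *)
Definition is_lebesgue (d : nat) (lam : {measure set (d.-tuple R) -> \bar R}) : Prop :=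
  forall a b : d.-tuple R,
    lam [set x | forall i : 'I_d, tnth a i < tnth x i <= tnth b i] =
    (\prod_(i < d) Num.max (tnth b i - tnth a i) 0)%:E.

Definition clf (F : normedModType R) (L : F -> R) : Prop :=
  (forall (a : R) (f g : F), L (a *: f + g) = a * L f + L g) /\ continuous L.

Context (d : nat) (lam : {measure set (d.-tuple R) -> \bar R})
  (D : set (d.-tuple R)) (rho : d.-tuple R -> R)
  (F : completeNormedModType R) (iota : F -> d.-tuple R -> R)
  (mu : probability (g_sigma_algebraType (@open F)) R).

Definition normG2 (g : d.-tuple R -> R) : \bar R :=
  (\int[lam]_(x in D) ((g x) ^+ 2 * rho x)%:E)%E.

(** Standing assumptions of the setting, for one dimension d.
    [iota f] is the function on D_d represented by f : F_d. *)
Definition standing : Prop :=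
  [/\ is_lebesgue lam /\
      (measurable D /\ (0 < lam D)%E),
      [/\ measurable_fun D rho, (forall x, D x -> 0 <= rho x) &
          (\int[lam]_(x in D) (rho x)%:E = 1)%E],
      [/\ (forall (a : R) (f g : F) x, D x -> iota (a *: f + g) x = a * iota f x + iota g x),
          (forall f g : F, (forall x, D x -> iota f x = iota g x) -> f = g) &
          exists s : nat -> F, dense (range s)] /\
      (forall x, D x -> continuous (fun f : F => iota f x)),
      [/\ (forall f : F, measurable_fun D (iota f)),
          (exists C : R, forall f : F, (normG2 (iota f) <= (C * `|f| ^+ 2)%:E)%E) &
          (forall f : F, normG2 (iota f) = 0%E -> f = 0)] &
      (* mu_d zero-mean Gaussian: every continuous linear functional is
         N(0, s^2)-distributed (s = 0 : Dirac at 0) *)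
      (forall L : F -> R, clf L -> exists s : R, 0 <= s /\
         forall A : set R, measurable A ->
           mu (L @^-1` A) = (if s == 0 then \d_(0 : R) A else normal_prob 0 s A))].

Definition in_class (c : info_class) (L : F -> R) : Prop :=
  match c with
  | Lall => clf L
  | Lstd => exists2 x, D x & L = (fun f => iota f x)
  end.

Definition info (n : nat) (L : 'I_n -> F -> R) (f : F) : n.-tuple R :=
  [tuple L i f | i < n].

Definition err2 (n : nat) (L : 'I_n -> F -> R) (phi : n.-tuple R -> d.-tuple R -> R) : \bar R :=
  (\int[mu]_f normG2 (fun x => (iota f x - phi (info L f) x)%R))%E.

(** phi : R^n -> G_d measurable (as a jointly measurable kernel) *)
Definition measurable_alg (n : nat) (phi : n.-tuple R -> d.-tuple R -> R) : Prop :=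
  measurable_fun setT (fun p : n.-tuple R * d.-tuple R => phi p.1 p.2).

Definition Gamma : \bar R := (\int[mu]_f normG2 (iota f))%E.

Definition eavg (c : info_class) (n : nat) : \bar R :=
  if n is 0 then sqrte Gamma else
  sqrte (ereal_inf [set e | exists (L : 'I_n -> F -> R)
                                   (phi : n.-tuple R -> d.-tuple R -> R),
                      [/\ forall i, in_class c (L i), measurable_alg phi & e = err2 L phi]]).

Definition CRI (crit : err_crit) : \bar R :=
  match crit with ABS => 1%E | NOR => sqrte Gamma end.

(** information complexity n^star(eps,d;Lambda) (+oo if no such n) *)
Definition ncomp (c : info_class) (crit : err_crit) (eps : R) : \bar R :=
  ereal_inf [set (n%:R)%:E | n in [set n : nat | (eavg c n <= eps%:E * CRI crit)%E]].

End Level.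

Unset Implicit Arguments.

Section Family.
Context {R : realType}
  (lam : forall d : nat, {measure set (d.-tuple R) -> \bar R})
  (D : forall d : nat, set (d.-tuple R))
  (rho : forall d : nat, d.-tuple R -> R)
  (F : nat -> completeNormedModType R)
  (iota : forall d : nat, F d -> d.-tuple R -> R)
  (mu : forall d : nat, probability (g_sigma_algebraType (@open (F d))) R).

Definition standing_all : Prop :=
  forall d : nat, (0 < d)%N -> @standing R d (lam d) (D d) (rho d) (F d) (iota d) (mu d).

Definition ncompF (c : info_class) (crit : err_crit) (eps : R) (d : nat) : \bar R :=
  @ncomp R d (lam d) (D d) (rho d) (F d) (iota d) (mu d) c crit eps.

Definition EXP_PT (c : info_class) (crit : err_crit) : Prop :=
  exists C p q : R, [/\ 0 < C, 0 <= p, 0 <= q &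
    forall (d : nat) (eps : R), (0 < d)%N -> 0 < eps < 1 ->
      (ncompF c crit eps d <= (C * (d%:R `^ q) * (1 + ln eps^-1) `^ p)%:E)%E].

Definition SPT_bound (c : info_class) (crit : err_crit) (C p : R) : Prop :=
  forall (d : nat) (eps : R), (0 < d)%N -> 0 < eps < 1 ->
    (ncompF c crit eps d <= (C * (1 + ln eps^-1) `^ p)%:E)%E.

Definition EXP_SPT (c : info_class) (crit : err_crit) : Prop :=
  exists C p : R, [/\ 0 < C, 0 <= p & SPT_bound c crit C p].

(** EXP-p^star(Lambda): infimum of the admissible exponents (+oo if none) *)
Definition EXP_p (c : info_class) (crit : err_crit) : \bar R :=
  ereal_inf [set p%:E | p in [set p : R | 0 <= p /\ exists C : R, 0 < C /\ SPT_bound c crit C p]].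

End Family.

(* Main.v *)
Require Import Defs.
From HB Require Import structures.
From mathcomp Require Import all_boot all_order all_algebra perm.
From mathcomp Require Import all_classical all_reals all_analysis measurable_realfun.
From mathcomp Require Import ring lra.
Set Implicit Arguments.
Unset Strict Implicit.
Unset Printing Implicit Defensive.
Import Order.TTheory GRing.Theory Num.Theory.
Import numFieldNormedType.Exports.
Local Open Scope classical_set_scope.
Local Open Scope ring_scope.

(** If n linear functionals achieve the average error e, then some m <= n function
    values achieve the error 6 (n + 1) e; since n grows only polylogarithmically in
    1/eps, this loss is absorbed by replacing eps with a power of eps.

    An arbitrary algorithm based on L_1, .., L_n can be replaced by the orthogonal
    projection of f(x) onto span(L_i) in L2(mu): the residual X of the projection is
    uncorrelated with the L_i, so (X, L) and (-X, L) have the same Gaussian law, and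
    averaging |X + psi(L)|^2 over the two signs shows that psi = 0 is optimal.

    Write the projection as sum_i a_i(x) M_i(f) with as few terms m as possible, and
    let V(x) be the variance of its residual at x.  Then the a_i are linearly
    independent and square integrable.  Interpolating the span of the a_i at points
    x_j that nearly maximise |det (a_i(x_j) / g(x_j))|, with
    g^2 = V + eta sum_i a_i^2, gives weights |W_j(x)| <= 2 g(x) / g(x_j).  The error
    of f(x) ~ sum_j W_j(x) f(x_j) is the error of the projection plus the
    interpolated residuals W_j(x) X(x_j), whose variances are at most 4 g(x)^2. *)

(** * Laws on R^n are determined by trigonometric moments *)

Section BoundedPointwiseClosure.
Context {R : realType} {n : nat}.
Implicit Types (f g : n.-tuple R -> R) (t : 'I_n -> R) (c : R).

(** The phase [c] makes constants and sines available as well, so that integrals of waves carry the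
    same information as a characteristic function, without complex numbers. *)
Definition wave t c : n.-tuple R -> R := fun y => cos (\sum_i t i * tnth y i + c).

(* Limits must be uniformly bounded for dominated convergence to apply.  The closure
   is an algebra; it contains the sign of each coordinate, as the limit of
   sg (sin (x / k)), where sg on [-1, 1] is the limit of the iterates of the
   polynomial smoothstep below. *)
Inductive bp_closure : (n.-tuple R -> R) -> Prop :=
| bp_wave t c : bp_closure (wave t c)
| bp_lin a b f g : bp_closure f -> bp_closure g ->
    bp_closure (fun y => a * f y + b * g y)
| bp_lim (h : nat -> n.-tuple R -> R) f M :
    (forall k, bp_closure (h k)) -> (forall k y, `|h k y| <= M) ->
    (forall y, h k y @[k --> \oo] --> f y) -> bp_closure f.

Lemma bp_bounded f : bp_closure f -> exists M, forall y, `|f y| <= M.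
Proof.
elim=> [t c|a b {}f g _ [M fM] _ [N gN]|h {}f M _ _ hM hf].
- by exists 1 => y; rewrite cos_max.
- exists (`|a| * M + `|b| * N) => y; apply: le_trans (ler_normD _ _) _.
  by rewrite !normrM lerD// ler_wpM2l.
- exists M => y; have cn : `|h k y| @[k --> \oo] --> `|f y|.
    by apply: cvg_norm; exact: hf.
  rewrite -(cvg_lim _ cn)//; apply: limr_le; first by apply/cvg_ex; exists `|f y|.
  by apply: nearW => k; exact: hM.
Qed.

Lemma measurable_wave t c : measurable_fun setT (wave t c).
Proof.
apply: measurableT_comp; first by apply: continuous_measurable_fun; exact: continuous_cos.
apply: measurable_funD => //; apply: measurable_sum => i.
by apply: measurable_funM => //; exact: measurable_tnth.
Qed.

Lemma bp_measurable f : bp_closure f -> measurable_fun setT f.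
Proof.
elim=> [t c|a b {}f g _ mf _ mg|h {}f M _ mh _ hf].
- exact: measurable_wave.
- by apply: measurable_funD; apply: measurable_funM.
- by apply: (measurable_fun_cvg mh) => y _; exact: hf.
Qed.

Lemma bp_ext f g : f =1 g -> bp_closure f -> bp_closure g.
Proof. by move=> /funext ->. Qed.

Lemma bpZ a f : bp_closure f -> bp_closure (fun y => a * f y).
Proof.
by move=> bf; apply: bp_ext (bp_lin a 0 bf bf) => y; rewrite mul0r addr0.
Qed.

Lemma bpD f g : bp_closure f -> bp_closure g -> bp_closure (fun y => f y + g y).
Proof. by move=> bf bg; apply: bp_ext (bp_lin 1 1 bf bg) => y; rewrite !mul1r. Qed.

Lemma bpB f g : bp_closure f -> bp_closure g -> bp_closure (fun y => f y - g y).
Proof.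
by move=> bf bg; apply: bp_ext (bp_lin 1 (-1) bf bg) => y; rewrite mul1r mulN1r.
Qed.

Lemma bp_cst c : bp_closure (fun=> c).
Proof.
apply: bp_ext (bpZ c (bp_wave (fun=> 0) 0)) => y.
by rewrite /wave big1 ?addr0 ?cos0 ?mulr1// => i _; rewrite mul0r.
Qed.

(** Nested induction on both derivations: for two waves the product-to-sum formula applies, while
    linear combinations and bounded limits pass through one factor at a time. *)
Lemma bpM f g : bp_closure f -> bp_closure g -> bp_closure (fun y => f y * g y).
Proof.
move=> bf; elim: bf g => [t c|a b f1 f2 _ IH1 _ IH2|h {}f M bh IH hM hf] g bg.
- elim: bg => [s e|a b f1 f2 _ IH1 _ IH2|h f1 M bh IH hM hf].
  + apply: bp_ext (bp_lin 2^-1 2^-1 (bp_wave (fun i => t i + s i) (c + e))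
                          (bp_wave (fun i => t i - s i) (c - e))) => y.
    rewrite /wave; set u := \sum_i t i * _; set v := \sum_i s i * _.
    have -> : \sum_i (t i + s i) * tnth y i = u + v.
      by rewrite /u /v -big_split/=; apply: eq_bigr => i _; rewrite mulrDl.
    have -> : \sum_i (t i - s i) * tnth y i = u - v.
      rewrite /u /v -sumrB/=; apply: eq_bigr => i _; rewrite mulrBl//.
    have -> : u + v + (c + e) = (u + c) + (v + e) by ring.
    have -> : u - v + (c - e) = (u + c) - (v + e) by ring.
    by rewrite cosD cosB; field.
  + by apply: bp_ext (bp_lin a b IH1 IH2) => y; ring.
  + apply: (bp_lim IH (M := M)) => [k y|y].
      rewrite normrM -[leRHS]mul1r; apply: ler_pM => //; exact: cos_max.
    by apply: cvgM; [exact: cvg_cst|exact: hf].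
- by apply: bp_ext (bp_lin a b (IH1 _ bg) (IH2 _ bg)) => y; ring.
- have [N gN] := bp_bounded bg.
  apply: (bp_lim (fun k => IH k _ bg) (M := M * N)) => [k y|y].
    by rewrite normrM ler_pM.
  by apply: cvgM; [exact: hf|exact: cvg_cst].
Qed.

(** An odd cubic mapping [[-1, 1]] to itself. Its fixed points 1 and -1 attract and 0 repels, so the
    iterates tend to the sign while remaining polynomials. *)
Definition smoothstep (u : R) : R := (3 * u - u ^+ 3) / 2.

Lemma smoothstep_bound u : -1 <= u <= 1 -> -1 <= smoothstep u <= 1.
Proof.
move=> /andP[u0 u1].
(* [h1] and [h2] are the factorisations of [1 - smoothstep u] and [1 + smoothstep u]. *)
have h1 : 0 <= (1 - u) ^+ 2 * (2 + u) / 2.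
  by rewrite divr_ge0// mulr_ge0 ?sqr_ge0//; lra.
have h2 : 0 <= (1 + u) ^+ 2 * (2 - u) / 2.
  by rewrite divr_ge0// mulr_ge0 ?sqr_ge0//; lra.
rewrite /smoothstep; apply/andP; split; rewrite -subr_ge0.
  by apply: le_trans h2 _; rewrite le_eqVlt; apply/orP; left; apply/eqP; field.
by apply: le_trans h1 _; rewrite le_eqVlt; apply/orP; left; apply/eqP; field.
Qed.

Lemma iter_smoothstepN k u : iter k smoothstep (- u) = - iter k smoothstep u.
Proof. by elim: k => //= k ->; rewrite /smoothstep; field. Qed.

(** A step from [v >= u] multiplies the distance to 1 by [(1 - v) * (2 + v) / 2], which is at most
    [1 - v / 2], hence at most [1 - u / 2]. *)
Lemma iter_smoothstep_bound k u : 0 < u <= 1 ->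
  u <= iter k smoothstep u <= 1 /\ 1 - iter k smoothstep u <= (1 - u / 2) ^+ k.
Proof.
move=> /andP[u0 u1]; elim: k => [|k [/andP[uv v1] IH]] /=.
  by rewrite lexx u1 expr0; split => //; lra.
set v := iter k smoothstep u in uv v1 IH *.
have vs : v <= smoothstep v by rewrite /smoothstep; nra.
have /andP[_ s1] : -1 <= smoothstep v <= 1 by apply: smoothstep_bound; lra.
split; first by rewrite s1 (le_trans uv vs).
rewrite exprS; apply: (@le_trans _ _ ((1 - u / 2) * (1 - v))); last first.
  by apply: ler_wpM2l => //; lra.
have -> : 1 - smoothstep v = ((1 - v) * (2 + v) / 2) * (1 - v).
  by rewrite /smoothstep; field.
by apply: ler_wpM2r; [lra|nra].
Qed.

Lemma iter_smoothstep_norm k u : `|u| <= 1 -> `|iter k smoothstep u| <= 1.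
Proof.
rewrite !ler_norml => h; elim: k => //= k; exact: smoothstep_bound.
Qed.

Lemma cvg_iter_smoothstep u : `|u| <= 1 ->
  iter k smoothstep u @[k --> \oo] --> Num.sg u.
Proof.
have pos (v : R) : 0 < v <= 1 -> iter k smoothstep v @[k --> \oo] --> (1 : R).
  move=> v01; have /andP[v0 v1] := v01.
  apply/subr_cvg0; rewrite -oppr0.
  under eq_fun do rewrite -opprB.
  apply: cvgN; apply: (@squeeze_cvgr _ _ _ _ (fun=> 0) (fun k => (1 - v / 2) ^+ k)).
  - apply: nearW => k; have [/andP[a b] c] := iter_smoothstep_bound k v01.
    by rewrite c andbT subr_ge0.
  - exact: cvg_cst.
  - by apply: cvg_expr; rewrite ger0_norm; lra.
move=> u1; have [u0|u0|->] := ltrgt0P u.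
- by rewrite gtr0_sg//; apply: pos; rewrite u0 (le_trans (ler_norm _)).
- rewrite ltr0_sg//.
  rewrite -[u]opprK; under eq_fun do rewrite iter_smoothstepN.
  by apply: cvgN; apply: pos; rewrite oppr_gt0 u0/= (le_trans (ler_norm _))// normrN.
- rewrite sgr0; have -> : (fun k => iter k smoothstep 0) = fun=> 0.
    by apply/funext; elim=> //= k ->; rewrite /smoothstep; field.
  exact: cvg_cst.
Qed.

(** The sequence is eventually constant: once [k.+1 > |x|], the argument lies in [(-1, 1)], where
    the sine has the sign of its argument. *)
Lemma cvg_sg_sin (x : R) : Num.sg (sin (x / k.+1%:R)) @[k --> \oo] --> Num.sg x.
Proof.
apply: cvg_near_cst; exists (Num.truncn `|x|) => // k /= hk.
have k0 : (0 : R) < k.+1%:R by [].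
have xk : `|x| < k.+1%:R.
  by apply: (lt_le_trans (truncnS_gt _)); rewrite ler_nat ltnS.
have pos (v : R) : 0 < v < k.+1%:R -> Num.sg (sin (v / k.+1%:R)) = 1.
  move=> /andP[v0 vk]; apply: gtr0_sg; apply: sin2_gt0.
  rewrite divr_gt0//= ltr_pdivrMr//; lra.
have [x0|x0|->] := ltrgt0P x.
- by rewrite (gtr0_sg x0) pos// x0 (le_lt_trans (ler_norm _)).
- rewrite (ltr0_sg x0) -[x]opprK mulNr sinN sgrN pos//.
  by rewrite oppr_gt0 x0 (le_lt_trans (ler_norm _))// normrN.
- by rewrite mul0r sin0.
Qed.

(** Two successive limits: iterating [smoothstep] turns a sine into its sign, and then letting the
    period grow gives the sign of the coordinate. *)
Lemma bp_sg (i : 'I_n) c : bp_closure (fun y => Num.sg (tnth y i - c)).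
Proof.
have bsin k : bp_closure (fun y => sin ((tnth y i - c) / k.+1%:R)).
  pose t j := if j == i then k.+1%:R^-1 : R else 0.
  (* The shift by [pi / 2] turns the cosine of [wave] into a sine. *)
  apply: bp_ext (bp_wave t (- c / k.+1%:R - pi / 2)) => y.
  rewrite /wave (bigD1 i)//= big1 => [|j /negbTE ji].
    by rewrite addr0 addrA cosBpihalf /t eqxx; congr sin; ring.
  by rewrite /t ji mul0r.
have bit k m : bp_closure (fun y => iter m smoothstep (sin ((tnth y i - c) / k.+1%:R))).
  elim: m => [|m IH] /=; first exact: bsin.
  apply: bp_ext (bp_lin (3 / 2) (- 2^-1) IH (bpM IH (bpM IH IH))) => y.
  by rewrite /smoothstep; field.
apply: (bp_lim (h := fun k y => Num.sg (sin ((tnth y i - c) / k.+1%:R))) (M := 1)).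
- move=> k; apply: (bp_lim (bit k) (M := 1)) => [m y|y].
    by apply: iter_smoothstep_norm; exact: sin_max.
  by apply: cvg_iter_smoothstep; exact: sin_max.
- by move=> k y; rewrite normr_sg lern1 leq_b1.
- by move=> y; exact: cvg_sg_sin.
Qed.

(** The sets whose indicator lies in the closure form a sigma-algebra; it contains the open
    half-spaces of each coordinate, which generate the product sigma-algebra. *)
Lemma bp_indic (A : set (n.-tuple R)) : measurable A -> bp_closure (\1_A).
Proof.
pose S := [set A : set (n.-tuple R) | bp_closure \1_A].
have SC B : S B -> S (~` B).
  move=> SB; apply: bp_ext (bpB (bp_cst 1) SB) => y.
  by rewrite !indicE in_setC; case: (y \in B) => /=; rewrite ?subrr ?subr0.
have SU B C : S B -> S C -> S (B `|` C).
  move=> SB SC'; apply: bp_ext (bpB (bpD SB SC') (bpM SB SC')) => y.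
  by rewrite !indicE in_setU; case: (y \in B); case: (y \in C) => /=; ring.
have SA : sigma_algebra setT S.
  split.
  - by apply: bp_ext (bp_cst 0) => y; rewrite indic0.
  - by move=> B /SC; rewrite setTD.
  - move=> B SB; apply: (bp_lim (h := fun k => \1_(\bigcup_(i < k) B i)) (M := 1)).
    + elim=> [|k IH]; first by apply: bp_ext (bp_cst 0) => y; rewrite II0 bigcup_set0 indic0.
      have : S (\bigcup_(i < k) B i `|` B k) by exact: SU.
      by rewrite !bigcup_mkord big_ord_recr.
    + by move=> k y; rewrite indicE; case: (y \in _); rewrite ?normr1 ?normr0.
    + move=> y; apply: cvg_near_cst.
      have [[i _ Bi]|nB] := pselect ((\bigcup_i B i) y).
        exists i.+1 => // k /= ik; rewrite !indicE !mem_set//; [by exists i|].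
        by exists i.
      exists 0%N => // k _ /=; rewrite !indicE !memNset// => -[i _ Bi].
      by apply: nB; exists i.
have coord (i : 'I_n) (B : set R) : measurable B -> S ((fun y => tnth y i) @^-1` B).
  pose S' := [set B : set R | S ((fun y => tnth y i) @^-1` B)].
  suff : measurable `<=` S' by apply.
  rewrite [X in X `<=` _](RGenOInfty.measurableE R); apply: smallest_sub => /=.
    case: SA => SA1 SA2 SA3; split.
    - by rewrite /S'/= preimage_set0.
    - by move=> C S'C; rewrite /S'/= setTD; exact: SC.
    - by move=> C S'C; rewrite /S'/= preimage_bigcup; exact: SA3.
  move=> _ [c ->]; rewrite /S'/S/=.
  (* With [s] the sign of [y_i - c], the indicator of [y_i > c] is [(s + s ^+ 2) / 2], which is
     correctly 0 at [s = 0]. *)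
  apply: bp_ext (bp_lin 2^-1 2^-1 (bp_sg i c) (bpM (bp_sg i c) (bp_sg i c))) => y.
  rewrite indicE; have [h|h] := ltP c (tnth y i).
    by rewrite mem_set/= ?in_itv/= ?h// gtr0_sg ?subr_gt0//; field.
  rewrite memNset/= ?in_itv/= ?andbT; last by apply/negP; rewrite -leNgt.
  move: h; rewrite le_eqVlt => /orP[/eqP->|h]; first by rewrite subrr sgr0; ring.
  by rewrite ltr0_sg ?subr_lt0//; field.
suff : measurable `<=` S by apply.
apply: smallest_sub => // B; rewrite -bigcup_seq => -[i _ [C mC <-]].
by rewrite setTI; exact: coord.
Qed.

End BoundedPointwiseClosure.

(** Equality of integrals extends from waves to the whole of [bp_closure], limits being handled by
    dominated convergence with a constant bound, and indicators belong to that closure. *)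
Lemma cramer_wold (R : realType) (n : nat)
    (P Q : {finite_measure set (n.-tuple R) -> \bar R}) :
  (forall t c, \int[P]_y (wave t c y)%:E = \int[Q]_y (wave t c y)%:E)%E ->
  forall A, measurable A -> P A = Q A.
Proof.
move=> PQ A mA.
have fin (m : {finite_measure set (n.-tuple R) -> \bar R}) f :
    bp_closure f -> m.-integrable setT (EFin \o f).
  move=> bf; have [M fM] := bp_bounded bf.
  apply: measurable_bounded_integrable => //.
  - by rewrite -ge0_fin_numE//; exact: fin_num_measure.
  - exact: bp_measurable.
  - exists M; split; first exact: num_real.
    by move=> N MN y _ /=; exact: le_trans (fM y) (ltW MN).
have key f : bp_closure f -> (\int[P]_y (f y)%:E = \int[Q]_y (f y)%:E)%E.
  move=> bf; elim: bf (bf) => [t c _|a b {}f g bf IHf bg IHg _|h {}f M bh IH hM hf bf].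
  - exact: PQ.
  - have e (m : {finite_measure set (n.-tuple R) -> \bar R}) :
      (\int[m]_y (a * f y + b * g y)%:E =
        a%:E * \int[m]_y (f y)%:E + b%:E * \int[m]_y (g y)%:E)%E.
      under eq_integral do rewrite EFinD !EFinM.
      rewrite integralD//=; [|exact/integrableZl/fin|exact/integrableZl/fin] => //.
      by rewrite !integralZl//; exact: fin.
    by rewrite !e IHf// IHg.
  - have e (m : {finite_measure set (n.-tuple R) -> \bar R}) :
      (\int[m]_y (h k y)%:E @[k --> \oo] --> \int[m]_y (f y)%:E)%E.
      have [] := @dominated_convergence _ _ _ m setT measurableT
        (fun k y => (h k y)%:E) (EFin \o f) (EFin \o cst M) => //.
      + by move=> k; apply/measurable_EFinP; exact: bp_measurable.
      + by apply/measurable_EFinP; exact: bp_measurable.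
      + by apply: aeW => y _; apply: cvg_EFin; [exact: nearW|exact: hf].
      + by apply: fin; exact: bp_cst.
      + by apply: aeW => y k _; rewrite lee_fin.
    have eP := e P; have eQ := e Q.
    have : (fun k => \int[P]_y (h k y)%:E)%E = (fun k => \int[Q]_y (h k y)%:E)%E.
      by apply/funext => k; exact: IH.
    move=> E; rewrite E in eP.
    exact: cvg_unique eP eQ.
by have := key _ (bp_indic mA); rewrite !integral_indic// !setIT.
Qed.

(** * Gaussian measures *)

Section NormalMoments.
Context {R : realType}.
Local Notation leb := (@lebesgue_measure R).

(** The Radon-Nikodym derivative of the normal law agrees almost everywhere with [normal_pdf], since
    both have the same integral over every measurable set. *)
Lemma ge0_integral_normal_prob (s : R) (f : R -> \bar R) :
  (forall x, 0 <= f x)%E -> measurable_fun setT f ->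
  (\int[normal_prob 0 s]_x f x = \int[leb]_x (f x * (normal_pdf 0 s x)%:E))%E.
Proof.
move=> f0 mf; have dom := @normal_prob_dominates R 0 s.
rewrite -(Radon_Nikodym_SigmaFinite.change_of_variables dom)//.
apply: ae_eq_integral => //.
- apply: emeasurable_funM => //.
  exact: measurable_int (Radon_Nikodym_SigmaFinite.f_integrable dom).
- apply: emeasurable_funM => //.
  by apply/measurable_EFinP; exact: measurable_normal_pdf.
- apply: ae_eqe_mul2l; apply: integral_ae_eq => //.
  + exact: Radon_Nikodym_SigmaFinite.f_integrable.
  + by apply/measurable_EFinP; exact: measurable_normal_pdf.
  + by move=> A _ mA; rewrite -Radon_Nikodym_SigmaFinite.f_integral.
Qed.

Let G (y : R) : R := y ^+ 2 * gauss_fun y.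

Let G0 y : 0 <= G y.
Proof. by rewrite mulr_ge0 ?sqr_ge0 ?gauss_fun_ge0. Qed.

Let contG : continuous G.
Proof.
move=> y; apply: cvgM; last exact: continuous_gauss_fun.
exact: sqr_continuous.
Qed.

Let mG : measurable_fun setT G.
Proof. exact: continuous_measurable_fun. Qed.

(** From [1 + y^2 / 2 <= exp (y^2 / 2)] follows [y^2 exp (- y^2) <= 2 exp (- y^2 / 2)], a multiple
    of the standard normal density. *)
Let int_G_lty : (\int[leb]_y (G y)%:E < +oo)%E.
Proof.
have p0 : 0 < normal_peak (1 : R) by rewrite normal_peak_gt0// oner_eq0.
apply: (@le_lt_trans _ _ (\int[leb]_y ((2 / normal_peak 1)%:E * (normal_pdf 0 1 y)%:E))%E).
  apply: ge0_le_integral => //.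
  - by move=> y _; rewrite lee_fin.
  - exact/measurable_EFinP.
  - by apply: emeasurable_funM => //; apply/measurable_EFinP; exact: measurable_normal_pdf.
  - move=> y _; rewrite -EFinM lee_fin /normal_pdf oner_eq0 mulrA divfK ?gt_eqF//.
    rewrite /G /gauss_fun /normal_fun subr0 expr1n.
    set h := expR (- y ^+ 2 / (1 *+ 2)).
    have -> : expR (- y ^+ 2) = h * h by rewrite /h -expRD; congr expR; field.
    rewrite mulrA ler_wpM2r ?expR_ge0// /h mulNr expRN ler_pdivrMr ?expR_gt0//.
    by have := expR_ge1Dx (y ^+ 2 / (1 *+ 2)); lra.
rewrite ge0_integralZl//=.
- by rewrite integral_normal_pdf mule1 ltry.
- by apply/measurable_EFinP; exact: measurable_normal_pdf.
- by move=> x _; rewrite lee_fin normal_pdf_ge0.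
- by rewrite lee_fin divr_ge0// ltW.
Qed.

Let int_G_gt0 : (0 < \int[leb]_y (G y)%:E)%E.
Proof.
apply: (@lt_le_trans _ _ (\int[leb]_(y in `[1%R, 2%R]) (expR (- 4))%:E)%E).
  rewrite integral_cst//= lebesgue_measure_itv/= lte_fin ltr1n -EFinD.
  by rewrite mule_gt0// lte_fin ?expR_gt0//; lra.
apply: (@le_trans _ _ (\int[leb]_(y in `[1%R, 2%R]) (G y)%:E)%E); last first.
  apply: ge0_subset_integral => //; first exact/measurable_EFinP.
  by move=> y _; rewrite lee_fin.
apply: ge0_le_integral => //.
- by apply/measurable_EFinP; apply: measurable_funTS.
- move=> y /=; rewrite in_itv/= => /andP[y1 y2]; rewrite lee_fin /G /gauss_fun.
  rewrite -[leLHS]mul1r ler_pM ?expR_ge0//; first nra.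
  by rewrite ler_expR; nra.
Qed.

(** What matters is that a single positive [K] serves all [s]: the second moment then determines
    [s]. *)
Lemma normal_second_moment : exists2 K : R, 0 < K & forall s : R, 0 < s ->
  (\int[normal_prob 0 s]_x (x ^+ 2)%:E = (K * s ^+ 2)%:E)%E.
Proof.
have G_fin : (\int[leb]_y (G y)%:E)%E \is a fin_num.
  rewrite ge0_fin_numE; first exact: int_G_lty.
  by apply: integral_ge0 => y _; rewrite lee_fin; exact: G0.
pose I := fine (\int[leb]_y (G y)%:E)%E.
have I0 : 0 < I by rewrite -lte_fin fineK//; exact: int_G_gt0.
have spi : 0 < Num.sqrt pi :> R by rewrite sqrtr_gt0 pi_gt0.
exists (2 / Num.sqrt pi * I); first by rewrite mulr_gt0// divr_gt0.
move=> s s0; rewrite ge0_integral_normal_prob; last 2 first.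
- by move=> x; rewrite lee_fin sqr_ge0.
- by apply/measurable_EFinP; exact: measurable_funX.
(* The substitution [y = x / r] turns the exponent [x^2 / (2 s^2)] into [y^2]. *)
pose r := Num.sqrt (s ^+ 2 *+ 2).
have r2 : r ^+ 2 = s ^+ 2 *+ 2 by rewrite sqr_sqrtr// mulrn_wge0// sqr_ge0.
have r0 : 0 < r by rewrite sqrtr_gt0 pmulrn_lgt0// exprn_gt0.
pose H (x : R^o) : R^o := x / r.
have H'E : H^`()%classic = cst r^-1.
  apply/funext => x; rewrite /H derive1E deriveM// derive_cst scaler0 add0r.
  by rewrite derive_id scaler1.
have e : (\int[leb]_y (G y)%:E = \int[leb]_x (((G \o H) * H^`()%classic) x)%:E)%E.
  apply: increasing_ge0_integration_by_substitutionT => //.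
  - by move=> x y xy; rewrite /H ltr_pM2r// invr_gt0.
  - by rewrite H'E => ?; exact: cvg_cst.
  - by rewrite H'E; exact: is_cvg_cst.
  - by rewrite H'E; exact: is_cvg_cst.
  - by apply/gt0_cvgMlNy; [rewrite invr_gt0|exact: cvg_id].
  - by apply/gt0_cvgMly; [rewrite invr_gt0|exact: cvg_id].
have -> : (2 / Num.sqrt pi * I * s ^+ 2)%:E =
    ((r ^+ 2 / Num.sqrt pi)%:E * \int[leb]_y (G y)%:E)%E.
  by rewrite -(fineK G_fin) -EFinM r2; congr EFin; rewrite -/I -mulr_natl; ring.
rewrite e -ge0_integralZl//; last 3 first.
- apply/measurable_EFinP; rewrite H'E; apply: measurable_funM => //.
  by apply: measurableT_comp => //; apply: measurable_funM.
- by move=> x _; rewrite lee_fin H'E /= fctE mulr_ge0 ?G0// fctE invr_ge0 ltW.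
- by rewrite lee_fin divr_ge0 ?sqr_ge0// ltW.
apply: eq_integral => x _; rewrite -!EFinM; congr EFin.
rewrite /normal_pdf gt_eqF// H'E /normal_peak /normal_fun subr0 /=.
rewrite [in RHS]fctE/= /G /H /gauss_fun.
rewrite -mulrnAl sqrtrM ?mulrn_wge0 ?sqr_ge0// -/r -r2.
rewrite expr_div_n mulNr; field.
by rewrite !gt_eqF.
Qed.

End NormalMoments.

(** Both integrals are taken against the common image measure; splitting [g] into positive and
    negative parts covers signed integrands. *)
Lemma eq_law_integral d d' (T : measurableType d) (U : measurableType d')
    (R : realType) (mu : probability T R) (X Y : T -> U) (g : U -> \bar R) :
  measurable_fun setT X -> measurable_fun setT Y -> measurable_fun setT g ->
  (forall A, measurable A -> mu (X @^-1` A) = mu (Y @^-1` A)) ->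
  (\int[mu]_w g (X w) = \int[mu]_w g (Y w))%E.
Proof.
move=> mX mY mg XY.
pose X' : {mfun T >-> U} := HB.pack X (isMeasurableFun.Build _ _ _ _ X mX).
pose Y' : {mfun T >-> U} := HB.pack Y (isMeasurableFun.Build _ _ _ _ Y mY).
have ge0 (h : U -> \bar R) : measurable_fun setT h -> (forall u, 0 <= h u)%E ->
    (\int[mu]_w h (X w) = \int[mu]_w h (Y w))%E.
  move=> mh h0.
  have <- := @ge0_integral_distribution _ _ _ _ _ mu X' _ mh h0.
  have <- := @ge0_integral_distribution _ _ _ _ _ mu Y' _ mh h0.
  by apply: eq_measure_integral => A mA _; exact: XY.
have posE (Z : T -> U) : ((fun w => g (Z w))^\+ = fun w => g^\+ (Z w))%E.
  by rewrite !funepos.unlock.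
have negE (Z : T -> U) : ((fun w => g (Z w))^\- = fun w => g^\- (Z w))%E.
  by rewrite !funeneg.unlock.
rewrite integralE [RHS]integralE !posE !negE !ge0//.
- exact: measurable_funeneg.
- exact: measurable_funepos.
Qed.

Section LinearFunctionals.
Context {R : realType} (F : normedModType R).
Implicit Types L M : F -> R.

Lemma clf_lin a L M : clf L -> clf M -> clf (fun f => a * L f + M f).
Proof.
move=> [linL cL] [linM cM]; split.
  by move=> b f g; rewrite linL linM; ring.
by move=> f; apply: cvgD; [apply: cvgM; [exact: cvg_cst|exact: cL]|exact: cM].
Qed.

Lemma clf0 : clf (fun _ : F => 0 : R).
Proof. by split; [move=> *; rewrite mulr0 addr0|move=> f; exact: cvg_cst]. Qed.

Lemma clfZ a L : clf L -> clf (fun f => a * L f).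
Proof.
move=> cL; have := clf_lin a cL clf0.
by under eq_fun do rewrite addr0.
Qed.

Lemma clf_sum n (t : 'I_n -> R) (L : 'I_n -> F -> R) :
  (forall i, clf (L i)) -> clf (fun f => \sum_i t i * L i f).
Proof.
elim: n t L => [|n IH] t L cL.
  by under eq_fun do rewrite big_ord0; exact: clf0.
under eq_fun do rewrite big_ord_recl.
by apply: clf_lin => //; exact: (IH (fun i => t (lift ord0 i)) (fun i => L (lift ord0 i))).
Qed.

Lemma clf_measurable L : clf L ->
  measurable_fun setT (L : g_sigma_algebraType (@open F) -> R).
Proof.
move=> [_ cL]; apply: (measurability _ (RGenOInfty.measurableE R)).
move=> _ [_ [a ->] <-]; rewrite setTI; apply: sub_sigma_algebra.
by apply: open_comp; [move=> f _; exact: cL|exact: rray_open].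
Qed.

End LinearFunctionals.

(** * Covariances and joint laws of functionals under a Gaussian measure *)

Section GaussianMeasure.
Context {R : realType} (F : completeNormedModType R).
Local Notation T := (g_sigma_algebraType (@open F)).
Context (mu : probability T R).
Hypothesis gauss : forall L : F -> R, clf L -> exists s : R, 0 <= s /\
  forall A : set R, measurable A ->
    mu (L @^-1` A) = (if s == 0 then \d_(0 : R) A else normal_prob 0 s A).
Implicit Types L M X : F -> R.

Lemma clf_law_moment (K : R) L : clf L ->
  (forall s : R, 0 < s -> (\int[normal_prob 0 s]_x (x ^+ 2)%:E = (K * s ^+ 2)%:E)%E) ->
  exists2 s, 0 <= s & [/\ (forall A, measurable A ->
    mu (L @^-1` A) = (if s == 0 then \d_(0 : R) A else normal_prob 0 s A)) &
    (\int[mu]_f ((L f) ^+ 2)%:E = (K * s ^+ 2)%:E)%E].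
Proof.
move=> cL HK; have [s [s0 law]] := gauss cL; exists s => //; split => //.
have mL : measurable_fun setT (L : T -> measurableTypeR R).
  by move=> mT Y mY; exact: (clf_measurable cL mT mY).
pose L' : {mfun T >-> measurableTypeR R} := HB.pack (L : T -> measurableTypeR R)
  (isMeasurableFun.Build _ _ _ _ _ mL).
have msq : measurable_fun setT (fun x : measurableTypeR R => (x ^+ 2)%:E).
  by apply/measurable_EFinP; exact: measurable_funX.
have sq0 (x : R) : (0 <= (x ^+ 2)%:E)%E by rewrite lee_fin sqr_ge0.
have := @ge0_integral_distribution _ _ _ _ _ mu L' _ msq sq0.
move=> <-; have [s00|s_neq0] := eqVneq s 0.
  transitivity (\int[\d_(0%R : measurableTypeR R)]_x (x ^+ 2)%:E)%E.
    apply: (@eq_measure_integral _ (measurableTypeR R) R setT (\d_(0%R : measurableTypeR R))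
      (distribution mu L')) => A mA _.
    by rewrite -[LHS]/(mu (L @^-1` A)) law// s00 eqxx.
  by rewrite integral_dirac// expr0n/= mule0 s00 expr0n mulr0.
rewrite -HK ?lt_neqAle ?s0 1?eq_sym ?s_neq0//.
apply: (@eq_measure_integral _ (measurableTypeR R) R setT (normal_prob 0 s)
  (distribution mu L')) => A mA _.
by rewrite -[LHS]/(mu (L @^-1` A)) law// (negbTE s_neq0).
Qed.

Lemma clf_sqr_lty L : clf L -> (\int[mu]_f ((L f) ^+ 2)%:E < +oo)%E.
Proof.
have [K _ HK] := @normal_second_moment R.
by move=> cL; have [s _ [_ ->]] := clf_law_moment cL HK; rewrite ltry.
Qed.

(** A centred normal law on the line, including the Dirac mass at 0, is fixed by its second
    moment. *)
Lemma clf_law L M : clf L -> clf M ->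
  (\int[mu]_f ((L f) ^+ 2)%:E = \int[mu]_f ((M f) ^+ 2)%:E)%E ->
  forall A, measurable A -> mu (L @^-1` A) = mu (M @^-1` A).
Proof.
have [K K0 HK] := @normal_second_moment R.
move=> cL cM; have [s s0 [lawL ->]] := clf_law_moment cL HK.
have [u u0 [lawM ->]] := clf_law_moment cM HK.
move=> Ksu0; have Ksu := EFin_inj Ksu0; have su := mulfI (lt0r_neq0 K0) Ksu.
have su' : s = u by apply/eqP; rewrite -(@eqrXn2 _ 2)// su.
by move=> A mA; rewrite (lawL A mA) (lawM A mA) su'.
Qed.

Lemma clf_integrable_sqr L : clf L -> mu.-integrable setT (fun f => ((L f) ^+ 2)%:E).
Proof.
move=> cL; apply/integrableP; split.
  by apply/measurable_EFinP; apply: measurable_funX; exact: clf_measurable.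
under eq_integral do rewrite gee0_abs ?lee_fin ?sqr_ge0//.
exact: clf_sqr_lty.
Qed.

Lemma clf_integrable_mul L M : clf L -> clf M ->
  mu.-integrable setT (fun f => (L f * M f)%:E).
Proof.
move=> cL cM.
apply: (@le_integrable _ _ _ mu setT measurableT _
          (fun f => ((L f) ^+ 2)%:E + ((M f) ^+ 2)%:E)%E).
- by apply/measurable_EFinP; apply: measurable_funM; exact: clf_measurable.
- move=> f _; rewrite -EFinD !abse_EFin lee_fin [leRHS]ger0_norm ?addr_ge0 ?sqr_ge0//.
  by rewrite ler_norml; apply/andP; split; nra.
- by apply: integrableD => //; exact: clf_integrable_sqr.
Qed.

Definition cov L M : R := \int[mu]_f (L f * M f).

Lemma covC L M : cov L M = cov M L.
Proof. by apply: eq_Rintegral => f _; rewrite mulrC. Qed.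

Lemma cov_lin a L M X : clf L -> clf M -> clf X ->
  cov X (fun f => a * L f + M f) = a * cov X L + cov X M.
Proof.
move=> cL cM cX; rewrite /cov.
under eq_Rintegral do rewrite mulrDr mulrCA.
rewrite RintegralD//.
- by rewrite RintegralZl//; exact: clf_integrable_mul.
- have := integrableZl measurableT a (clf_integrable_mul cX cL).
  by apply: eq_integrable => // f _; rewrite /= EFinM.
- exact: clf_integrable_mul.
Qed.

Lemma cov0 X : cov X (fun=> 0) = 0.
Proof.
rewrite /cov; under eq_Rintegral do rewrite mulr0.
by rewrite Rintegral_cst// mul0r.
Qed.

Lemma cov_sum n (t : 'I_n -> R) (L : 'I_n -> F -> R) X : clf X ->
  (forall i, clf (L i)) ->
  cov X (fun f => \sum_i t i * L i f) = \sum_i t i * cov X (L i).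
Proof.
move=> cX; elim: n t L => [|n IH] t L cL.
  by rewrite big_ord0 -[RHS](cov0 X); apply: eq_Rintegral => f _; rewrite big_ord0.
rewrite big_ord_recl -IH// -cov_lin//; last exact: clf_sum.
by apply: eq_Rintegral => f _; rewrite big_ord_recl.
Qed.

Lemma cov_sqr L : clf L -> (\int[mu]_f ((L f) ^+ 2)%:E = (cov L L)%:E)%E.
Proof.
move=> cL; rewrite /cov /Rintegral fineK//.
apply: integrable_fin_num => //; exact: clf_integrable_mul.
Qed.

Lemma cov_ge0 L : 0 <= cov L L.
Proof. by apply: Rintegral_ge0 => f _; rewrite -expr2 sqr_ge0. Qed.

Lemma cov_lin_sqr a L M : clf L -> clf M ->
  cov (fun f => a * L f + M f) (fun f => a * L f + M f) =
  a ^+ 2 * cov L L + 2 * a * cov L M + cov M M.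
Proof.
move=> cL cM; have := clf_lin a cL cM; set N := fun f => _ => cN.
by rewrite [LHS]cov_lin// (covC N L) (covC N M) !cov_lin// (covC M L); ring.
Qed.

Lemma measurable_info n (L : 'I_n -> F -> R) : (forall i, clf (L i)) ->
  measurable_fun setT (info L : T -> n.-tuple R).
Proof.
move=> cL; apply/measurable_fun_tnthP => i.
have -> : (tnth (T := R))^~ i \o (info L : T -> _) = L i.
  by apply/funext => f; rewrite /= tnth_mktuple.
exact: clf_measurable.
Qed.

(** By [cramer_wold] it suffices to compare the laws of linear combinations; these are functionals,
    so by [clf_law] only their variances matter. *)
Lemma uncorrelated_law n X (L : 'I_n -> F -> R) : clf X -> (forall i, clf (L i)) ->
  (forall i, cov X (L i) = 0) -> forall A, measurable A ->
  mu ((fun f => [tuple of X f :: info L f]) @^-1` A) =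
  mu ((fun f => [tuple of - X f :: info L f]) @^-1` A).
Proof.
move=> cX cL XL.
have mv (Y : F -> R) : clf Y ->
    measurable_fun setT ((fun f => [tuple of Y f :: info L f]) : T -> n.+1.-tuple R).
  by move=> cY; apply: measurable_cons; [exact: clf_measurable|exact: measurable_info].
have cNX : clf (fun f => - X f).
  by have := clfZ (-1) cX; under eq_fun do rewrite mulN1r.
pose V (Y : F -> R) (cY : clf Y) : {mfun T >-> n.+1.-tuple R} :=
  HB.pack ((fun f => [tuple of Y f :: info L f]) : T -> n.+1.-tuple R)
    (isMeasurableFun.Build _ _ _ _ _ (mv Y cY)).
apply: (@cramer_wold R n.+1 (distribution mu (V _ cX)) (distribution mu (V _ cNX))) => t c.
pose W f := \sum_i t (lift ord0 i) * L i f.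
have cW : clf W by exact: clf_sum.
have waveE (Y : F -> R) f :
    wave t c [tuple of Y f :: info L f] = cos (t ord0 * Y f + W f + c).
  rewrite /wave big_ord_recl; congr (cos (_ + _ + _)).
  by apply: eq_bigr => i _; rewrite tnthS tnth_mktuple.
have dE (Y : F -> R) (cY : clf Y) :
    (\int[distribution mu (V Y cY)]_y (wave t c y)%:E =
     \int[mu]_f (cos (t ord0 * Y f + W f + c))%:E)%E.
  rewrite integral_distribution//=.
  - by apply: eq_integral => f _; rewrite /= waveE.
  - by apply/measurable_EFinP; exact: measurable_wave.
  - apply: (@measurable_bounded_integrable _ _ _ _ (wave t c \o V Y cY)) => //.
    + exact: (le_lt_trans (probability_le1 mu measurableT) (ltry 1)).
    + by apply: measurableT_comp => //; exact: measurable_wave.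
    + exists 1; split; first exact: num_real.
      by move=> N N1 f _ /=; rewrite (le_trans (cos_max _)) ?ltW.
rewrite !dE; pose g (x : R) := (cos (x + c))%:E.
have mg : measurable_fun setT g.
  apply/measurable_EFinP; apply: measurableT_comp.
    by apply: continuous_measurable_fun; exact: continuous_cos.
  exact: measurable_funD.
have cU (Y : F -> R) : clf Y -> clf (fun f => t ord0 * Y f + W f).
  by move=> cY; exact: clf_lin.
have mU (Y : F -> R) : clf Y -> measurable_fun setT ((fun f => t ord0 * Y f + W f) : T -> R).
  by move=> cY; apply: clf_measurable; exact: cU.
apply: (eq_law_integral (mU _ cX) (mU _ cNX) mg); apply: clf_law => //; [exact: cU|exact: cU|].
(* The sign of [X] enters the variance of [t ord0 * X + W] only through this covariance. *)
have XW0 : cov X W = 0 by rewrite cov_sum// big1// => i _; rewrite XL mulr0.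
rewrite !cov_sqr//; [|exact: cU|exact: cU]; congr EFin.
have -> : (fun f => t ord0 * - X f + W f) = (fun f => - t ord0 * X f + W f).
  by apply/funext => f; rewrite mulrN mulNr.
by rewrite !cov_lin_sqr// XW0; ring.
Qed.

(* Flipping the sign of X preserves the joint law of (X, L), so psi(L) can be
   averaged over X and -X, and the cross term cancels. *)
Lemma uncorrelated_optimal n X (L : 'I_n -> F -> R) (psi : n.-tuple R -> R) :
  clf X -> (forall i, clf (L i)) -> (forall i, cov X (L i) = 0) ->
  measurable_fun setT psi ->
  (\int[mu]_f ((X f) ^+ 2)%:E <= \int[mu]_f ((X f + psi (info L f)) ^+ 2)%:E)%E.
Proof.
move=> cX cL XL mpsi.
have cNX : clf (fun f => - X f).
  by have := clfZ (-1) cX; under eq_fun do rewrite mulN1r.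
have mv (Y : F -> R) : clf Y ->
    measurable_fun setT ((fun f => [tuple of Y f :: info L f]) : T -> n.+1.-tuple R).
  by move=> cY; apply: measurable_cons; [exact: clf_measurable|exact: measurable_info].
pose g (y : n.+1.-tuple R) := ((tnth y ord0 + psi [tuple of behead y]) ^+ 2)%:E.
have mg : measurable_fun setT g.
  apply/measurable_EFinP; apply: measurable_funX; apply: measurable_funD.
    exact: measurable_tnth.
  by apply: measurableT_comp => //; exact: measurable_behead.
have := eq_law_integral (mv _ cX) (mv _ cNX) mg (uncorrelated_law cX cL XL).
have gE (Y : F -> R) f :
    g [tuple of Y f :: info L f] = ((Y f + psi (info L f)) ^+ 2)%:E.
  rewrite /g; congr (EFin ((_ + psi _) ^+ 2)); exact: val_inj.
under eq_integral do rewrite gE.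
under [X in _ = X -> _]eq_integral do rewrite (gE (fun f => - X f)).
move=> E.
have mS (Y : F -> R) : clf Y ->
    measurable_fun setT (fun f : T => ((Y f + psi (info L f)) ^+ 2)%:E).
  move=> cY; apply/measurable_EFinP; apply: measurable_funX; apply: measurable_funD.
    exact: clf_measurable.
  by apply: measurableT_comp => //; exact: measurable_info.
have mX2 : measurable_fun setT (fun f : T => ((X f) ^+ 2)%:E).
  by apply/measurable_EFinP; apply: measurable_funX; exact: clf_measurable.
set a := (\int[mu]_f ((X f) ^+ 2)%:E)%E.
set b := (\int[mu]_f ((X f + psi (info L f)) ^+ 2)%:E)%E in E *.
have : (a + a <= b + b)%E.
  rewrite [in X in (_ <= _ + X)%E]E /a /b -!ge0_integralD//; first last.
  - by move=> f _; rewrite lee_fin sqr_ge0.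
  - by move=> f _; rewrite lee_fin sqr_ge0.
  - exact: (mS _ cNX).
  - by move=> f _; rewrite lee_fin sqr_ge0.
  - exact: (mS _ cX).
  - by move=> f _; rewrite lee_fin sqr_ge0.
  apply: ge0_le_integral => //.
  - by move=> f _; rewrite -EFinD lee_fin addr_ge0 ?sqr_ge0.
  - exact: emeasurable_funD.
  - by apply: emeasurable_funD; [exact: (mS _ cX)|exact: (mS _ cNX)].
  - move=> f _; rewrite -!EFinD lee_fin.
    by have := sqr_ge0 (psi (info L f)); nra.
(* The second moment [a] is finite, so halving [a + a <= b + b] is legitimate; [b] may be [+oo]. *)
rewrite /a cov_sqr//; case: b {E} => [r| |]; rewrite ?leey//=.
by rewrite -!EFinD !lee_fin; lra.
Qed.

End GaussianMeasure.

(** * Errors as integrals over the product of F and D *)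

Section ProductStructure.
Context {R : realType} {d : nat} (lam : {measure set (d.-tuple R) -> \bar R})
  (D : set (d.-tuple R)) (rho : d.-tuple R -> R)
  (F : completeNormedModType R) (iota : F -> d.-tuple R -> R)
  (mu : probability (g_sigma_algebraType (@open F)) R).
Hypothesis st : standing lam D rho iota mu.
Local Notation T := (g_sigma_algebraType (@open F)).
Local Notation X := (d.-tuple R).

Lemma lebesgue_sigma_finite : sigma_finite setT lam.
Proof.
case: st => -[leb _] _ _ _ _.
pose a k : X := [tuple - (k%:R : R) | i < d].
pose b k : X := [tuple (k%:R : R) | i < d].
exists (fun k => [set x | forall i : 'I_d, tnth (a k) i < tnth x i <= tnth (b k) i]).
  apply/esym; rewrite -subTset => x _.
  exists (\max_(i < d) (Num.truncn `|tnth x i|).+1)%N => // i.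
  rewrite !tnth_mktuple.
  have h : `|tnth x i| < (\max_(i < d) (Num.truncn `|tnth x i|).+1)%:R.
    apply: lt_le_trans (truncnS_gt _) _; rewrite ler_nat.
    exact: (leq_bigmax_cond (F := fun i => (Num.truncn `|tnth x i|).+1)).
  by move: h; rewrite ltr_norml => /andP[-> /ltW].
move=> k; split; last by rewrite leb ltry.
rewrite [X in measurable X](_ : _ = \bigcap_(i in [set: 'I_d])
    ((fun x : X => tnth x i) @^-1` `]tnth (a k) i, tnth (b k) i]%classic)).
  apply: fin_bigcap_measurable => [|i _]; first exact: finite_finset.
  by rewrite -[X in measurable X]setTI; exact: measurable_tnth.
apply/seteqP; split=> x /= h i; first by move=> _; rewrite /= in_itv/=; exact: h.
by have := h i I; rewrite /= in_itv.
Qed.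

(** The measure [lam] itself, equipped with the sigma-finite structure required by Tonelli's
    theorem. *)
Definition lam_sf : {sigma_finite_measure set X -> \bar R} :=
  HB.pack_for {sigma_finite_measure set X -> \bar R} (Measure.sort lam)
    (isSFinite.Build _ _ _ _ (sfinite_measure_sigma_finite lebesgue_sigma_finite))
    (isSigmaFinite.Build _ _ _ _ lebesgue_sigma_finite).

(** Extension by zero, here and in [weight], replaces integrals over [D] by integrals over the whole
    space. *)
Definition value f : X -> R := iota f \_ D.
Definition weight : X -> R := rho \_ D.

Lemma weight_ge0 x : 0 <= weight x.
Proof.
case: st => _ [_ r0 _] _ _ _; rewrite /weight patchE; case: ifPn => //.
by rewrite inE; exact: r0.
Qed.

Lemma measurable_weight : measurable_fun setT weight.
Proof.
case: st => -[_ [mD _]] [mr _ _] _ _ _.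
exact: (measurable_restrictT rho mD).1.
Qed.

Lemma clf_value x : clf (value ^~ x).
Proof.
case: st => _ _ [[lin _ _] cts] _ _.
have [Dx|nDx] := pselect (D x).
  have -> : value ^~ x = iota ^~ x.
    by apply/funext => f; rewrite /value patchE mem_set.
  by split; [move=> a f g; exact: lin|exact: cts].
have -> : value ^~ x = fun=> 0.
  by apply/funext => f; rewrite /value patchE memNset.
exact: clf0.
Qed.

Lemma measurable_value f : measurable_fun setT (value f).
Proof.
case: st => -[_ [mD _]] _ _ [mi _ _] _.
exact: (measurable_restrictT (iota f) mD).1.
Qed.

(* Carathéodory: continuous in f, measurable in x, and F is separable. *)
Lemma measurable_eval : measurable_fun setT (fun p : T * X => value p.1 p.2).
Proof.
case: st => _ _ [[_ _ [s ds]] _] _ _.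
have ex k (f : F) : exists j, `|f - s j| < k.+1%:R^-1.
  have r0 : 0 < k.+1%:R^-1 :> R by rewrite invr_gt0.
  have ne : ball f k.+1%:R^-1 !=set0 by exists f; exact: ballxx.
  have op : open (ball f k.+1%:R^-1) by exact: ball_open.
  have [g [/= fg [j _ jg]]] := ds _ ne op.
  by exists j; move: fg; rewrite -jg -ball_normE.
(* Taking the least index makes [f] to [s (idx k f)] a measurable map with countably many values:
   its level sets are differences of balls and finite unions of balls. *)
pose idx k f := ex_minn (ex k f).
have midx k j : measurable [set f : T | idx k f = j].
  have mB i : measurable [set f : T | `|f - s i| < k.+1%:R^-1].
    apply: sub_sigma_algebra.
    rewrite (_ : [set f | _] = ball (s i) k.+1%:R^-1); first by apply: ball_open; rewrite invr_gt0.
    by apply/seteqP; split => f; rewrite -ball_normE /ball_/= distrC.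
  rewrite (_ : [set f : T | _] = [set f : T | `|f - s j| < k.+1%:R^-1] `\`
      \bigcup_(i < j) [set f : T | `|f - s i| < k.+1%:R^-1]).
    by apply: measurableD => //; apply: bigcup_measurable.
  apply/seteqP; split=> f /=.
    rewrite /idx; case: ex_minnP => m fm min <-; split => // -[i /= im fi].
    by have := min _ fi; rewrite leqNgt im.
  case=> fj nj; rewrite /idx; case: ex_minnP => m fm min.
  apply/eqP; rewrite eqn_leq min// leqNgt; apply/negP => mj.
  by apply: nj; exists m.
apply: (measurable_fun_cvg (h := fun k (p : T * X) => value (s (idx k p.1)) p.2)).
- move=> k _ Y mY; rewrite setTI.
  rewrite (_ : _ @^-1` _ = \bigcup_j ([set f : T | idx k f = j] `*` (value (s j) @^-1` Y))).
    apply: bigcup_measurable => j _; apply: measurableX; first exact: midx.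
    by rewrite -[X in measurable X]setTI; exact: measurable_value.
  apply/seteqP; split=> -[f x] /=; first by move=> h; exists (idx k f).
  by move=> [j _ [/= <-]].
- move=> [f x] _ /=; have [_ cx] := clf_value x.
  apply: (cvg_comp (fun k => s (idx k f)) (value ^~ x)); last exact: cx.
  apply/cvgrPdist_lt => e e0.
  near=> k; rewrite /idx; case: ex_minnP => m fm _.
  by apply: lt_trans fm _; near: k; exact: near_infty_natSinv_lt (PosNum e0).
Unshelve. all: by end_near. Qed.

Lemma normG2E h f : normG2 lam D rho (fun x => iota f x - h x) =
  (\int[lam_sf]_x ((value f x - h x) ^+ 2 * weight x)%:E)%E.
Proof.
rewrite /normG2 integral_mkcond; apply: eq_integral => x _.
rewrite /value /weight !patchE; case: ifPn => //.
by rewrite mulr0.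
Qed.

(** After this exchange the mean square error can be studied separately for each point [x]. *)
Lemma swap_error (g : T * X -> R) : measurable_fun setT g ->
  (\int[mu]_f \int[lam_sf]_x ((g (f, x)) ^+ 2 * weight x)%:E =
   \int[lam_sf]_x (\int[mu]_f ((g (f, x)) ^+ 2)%:E * (weight x)%:E))%E.
Proof.
move=> mg.
rewrite (@fubini_tonelli _ _ _ _ _ mu lam_sf
          (fun p => ((g p) ^+ 2 * weight p.2)%:E)).
- apply: eq_integral => x _; rewrite -ge0_integralZr//.
  + apply/measurable_EFinP; apply: measurable_funX.
    exact: (measurable_fun_pair1 (f := g)).
  + by move=> f _; rewrite lee_fin sqr_ge0.
  + by rewrite lee_fin weight_ge0.
- apply/measurable_EFinP; apply: measurable_funM; first exact: measurable_funX.
  by apply: measurableT_comp => //; exact: measurable_weight.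
- by move=> p; rewrite lee_fin mulr_ge0 ?sqr_ge0 ?weight_ge0.
Qed.

Lemma measurable_inner_sqr (g : T * X -> R) : measurable_fun setT g ->
  measurable_fun setT (fun x => \int[mu]_f ((g (f, x)) ^+ 2)%:E)%E.
Proof.
move=> mg.
apply: (@measurable_fun_fubini_tonelli_G _ _ _ _ R mu (fun p => ((g p) ^+ 2)%:E)).
- by apply/measurable_EFinP; exact: measurable_funX.
- by move=> p; rewrite lee_fin sqr_ge0.
Qed.

End ProductStructure.

(** * Optimality of linear algorithms *)

Section LinearAlgorithms.
Context {R : realType} {d : nat} (lam : {measure set (d.-tuple R) -> \bar R})
  (D : set (d.-tuple R)) (rho : d.-tuple R -> R)
  (F : completeNormedModType R) (iota : F -> d.-tuple R -> R)
  (mu : probability (g_sigma_algebraType (@open F)) R).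
Hypothesis st : standing lam D rho iota mu.
Local Notation T := (g_sigma_algebraType (@open F)).
Local Notation X := (d.-tuple R).
Local Notation lam' := (lam_sf st).
Local Notation val := (value D iota).
Local Notation w := (weight D rho).

Let gauss := let: And5 _ _ _ _ g := st in g.

Definition residual m (M : 'I_m -> F -> R) (a : 'I_m -> X -> R) x f : R :=
  val f x - \sum_i a i x * M i f.

Definition lin_error m (M : 'I_m -> F -> R) (a : 'I_m -> X -> R) : \bar R :=
  (\int[lam']_x (\int[mu]_f ((residual M a x f) ^+ 2)%:E * (w x)%:E))%E.

Lemma clf_residual m (M : 'I_m -> F -> R) (a : 'I_m -> X -> R) x :
  (forall i, clf (M i)) -> clf (residual M a x).
Proof.
move=> cM; have := clf_lin (-1) (clf_sum (a ^~ x) cM) (clf_value st x).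
by congr clf; apply/funext => f; rewrite mulN1r addrC.
Qed.

Lemma measurable_clf_fst L : clf L -> measurable_fun setT (fun p : T * X => L p.1).
Proof.
by move=> cL; exact: (measurableT_comp (clf_measurable cL) (@measurable_fst _ _ T X)).
Qed.

Lemma measurable_residual m (M : 'I_m -> F -> R) (a : 'I_m -> X -> R) :
  (forall i, clf (M i)) -> (forall i, measurable_fun setT (a i)) ->
  measurable_fun setT (fun p : T * X => residual M a p.2 p.1).
Proof.
move=> cM ma; apply: measurable_funB; first exact: (measurable_eval st).
apply: measurable_sum => i; apply: measurable_funM.
  by apply: measurableT_comp.
exact: measurable_clf_fst.
Qed.

(** By polarisation the covariance is a combination of second moments, which are measurable in [x]
    by Tonelli. *)
Lemma measurable_cov_value L : clf L -> measurable_fun setT (fun x => cov mu (val ^~ x) L).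
Proof.
move=> cL.
have mV (g : T * X -> R) : measurable_fun setT g -> (forall x, clf (fun f => g (f, x))) ->
    measurable_fun setT (fun x => cov mu (fun f => g (f, x)) (fun f => g (f, x))).
  move=> mg cg; apply/measurable_EFinP.
  rewrite (_ : _ \o _ = fun x => \int[mu]_f ((g (f, x)) ^+ 2)%:E)%E.
    exact: measurable_inner_sqr.
  by apply/funext => x; rewrite (cov_sqr gauss (cg x)).
have mval : measurable_fun setT (fun p : T * X => val p.1 p.2) by exact: (measurable_eval st).
have csum x : clf (fun f => 1 * val f x + L f) by apply: clf_lin => //; exact: (clf_value st).
have m1 : measurable_fun setT (fun x => cov mu (val ^~ x) (val ^~ x)).
  by apply: (mV (fun p => val p.1 p.2)) => // x; exact: (clf_value st).
have m2 : measurable_fun setT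
    (fun x => cov mu (fun f => 1 * val f x + L f) (fun f => 1 * val f x + L f)).
  apply: (mV (fun p => 1 * val p.1 p.2 + L p.1)) => //.
  by apply: measurable_funD; [exact: measurable_funM|exact: measurable_clf_fst].
rewrite (_ : (fun x => _) = fun x => 2^-1 *
  (cov mu (fun f => 1 * val f x + L f) (fun f => 1 * val f x + L f)
   - cov mu (val ^~ x) (val ^~ x) - cov mu L L)).
  by apply: measurable_funM => //; apply: measurable_funB => //; exact: measurable_funB.
apply/funext => x; rewrite (cov_lin_sqr gauss)//; last exact: (clf_value st).
by field.
Qed.

(** The second moment of [t * L + Y] is then affine in [t] and nonnegative for all [t], which forces
    its slope to vanish. *)
Lemma cov_degenerate Y L : clf Y -> clf L -> cov mu L L = 0 -> cov mu Y L = 0.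
Proof.
move=> cY cL L0.
have h t : 0 <= 2 * t * cov mu L Y + cov mu Y Y.
  by have := cov_ge0 mu (fun f => t * L f + Y f); rewrite (cov_lin_sqr gauss)// L0 mulr0 add0r.
rewrite covC; apply/eqP; apply: contraT => c0.
have := h (- (cov mu Y Y + 1) / (2 * cov mu L Y)).
rewrite (_ : _ + _ = -1); last by field.
by rewrite ler0N1.
Qed.

Lemma err2E n (L : 'I_n -> F -> R) phi : (forall i, clf (L i)) -> measurable_alg phi ->
  err2 lam D rho iota mu L phi =
  (\int[lam']_x (\int[mu]_f ((val f x - phi (info L f) x) ^+ 2)%:E * (w x)%:E))%E.
Proof.
move=> cL mphi; rewrite /err2.
under eq_integral do rewrite (normG2E st).
apply: (swap_error st (g := fun p => val p.1 p.2 - phi (info L p.1) p.2)).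
apply: measurable_funB; first exact: (measurable_eval st).
apply: (measurableT_comp (f := fun p : n.-tuple R * X => phi p.1 p.2)
  (g := fun p : T * X => (info L p.1, p.2))) => //.
apply: measurable_fun_pair => //.
exact: (measurableT_comp (measurable_info cL)).
Qed.

(* The orthogonal projection of f(x) onto span(L_1, .., L_n) in L2(mu); its
   coefficients solve the normal equations, through a generalised inverse of the
   possibly singular Gram matrix. *)
Lemma projection_coefficients n (L : 'I_n -> F -> R) : (forall i, clf (L i)) ->
  exists a : 'I_n -> X -> R, [/\ forall i, measurable_fun setT (a i),
    forall i x, ~ D x -> a i x = 0 &
    forall x i, cov mu (residual L a x) (L i) = 0].
Proof.
move=> cL.
pose G : 'M[R]_n := \matrix_(i, j) cov mu (L i) (L j).
pose b x : 'rV[R]_n := \row_j cov mu (val ^~ x) (L j).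
(* Solvability of the normal equations: a vector [c] with [G *m c = 0] yields a combination of the
   [L i] of zero variance, hence uncorrelated with [val ^~ x]. *)
have bG x : (b x <= G)%MS.
  rewrite submxE; apply/eqP/rowP => k; rewrite !mxE.
  pose c i := cokermx G i k.
  have cW := clf_sum c cL.
  transitivity (cov mu (val ^~ x) (fun f => \sum_i c i * L i f)).
    rewrite (cov_sum gauss)//; last exact: (clf_value st).
    by apply: eq_bigr => i _; rewrite mxE mulrC.
  apply: cov_degenerate => //; first exact: (clf_value st).
  rewrite (cov_sum gauss)// big1// => i _.
  rewrite covC (cov_sum gauss)//.
  have := congr1 (fun A : 'M[R]_n => A i k) (mulmx_coker G); rewrite !mxE => e.
  rewrite (_ : \sum_j _ = 0) ?mulr0// -[RHS]e.
  by apply: eq_bigr => j _; rewrite mxE mulrC.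
exists (fun i x => (b x *m pinvmx G) 0 i); split.
- move=> i; under eq_fun do rewrite mxE.
  apply: measurable_sum => j; apply: measurable_funM => //.
  by under eq_fun do rewrite mxE; exact: measurable_cov_value.
- move=> i x nDx; rewrite mxE big1// => j _.
  rewrite mxE (_ : cov _ _ _ = 0) ?mul0r// covC -[RHS](cov0 mu (L j)).
  by apply: eq_Rintegral => f _; rewrite /value patchE memNset.
- move=> x i; set a := fun i x => _.
  rewrite covC.
  have -> : residual L a x = fun f => -1 * (\sum_i a i x * L i f) + val f x.
    by apply/funext => f; rewrite mulN1r addrC.
  rewrite (cov_lin gauss)//; [|exact: clf_sum|exact: (clf_value st)].
  rewrite (cov_sum gauss)//.
  have := congr1 (fun A : 'rV[R]_n => A 0 i) (mulmxKpV (bG x)); rewrite mxE => e.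
  rewrite [cov mu _ (val ^~ x)]covC.
  have -> : cov mu (val ^~ x) (L i) = b x 0 i by rewrite mxE.
  rewrite -e mulN1r addrC; apply/eqP; rewrite subr_eq0; apply/eqP.
  by apply: eq_bigr => j _; congr (_ * _); rewrite mxE; exact: covC.
Qed.

(** For fixed [x], the error of [phi] is the residual of the projection plus a measurable function
    [psi] of the information, so [uncorrelated_optimal] applies pointwise. *)
Lemma linear_algorithm_optimal n (L : 'I_n -> F -> R) phi :
  (forall i, clf (L i)) -> measurable_alg phi ->
  exists a : 'I_n -> X -> R, [/\ forall i, measurable_fun setT (a i),
    forall i x, ~ D x -> a i x = 0 &
    (lin_error L a <= err2 lam D rho iota mu L phi)%E].
Proof.
move=> cL mphi; have [a [ma aD aL]] := projection_coefficients cL.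
exists a; split => //; rewrite err2E//.
have mval : measurable_fun setT (fun p : T * X => val p.1 p.2) by exact: (measurable_eval st).
have mpsi : measurable_fun setT (fun p : T * X => val p.1 p.2 - phi (info L p.1) p.2).
  apply: measurable_funB => //.
  apply: (measurableT_comp (f := fun p : n.-tuple R * X => phi p.1 p.2)
    (g := fun p : T * X => (info L p.1, p.2))) => //.
  apply: measurable_fun_pair => //.
  exact: (measurableT_comp (measurable_info cL)).
have mw : measurable_fun setT (fun x => (w x)%:E).
  by apply/measurable_EFinP; exact: (measurable_weight st).
apply: ge0_le_integral => //.
- move=> x _; apply: mule_ge0; last by rewrite lee_fin (weight_ge0 st).
  by apply: integral_ge0 => f _; rewrite lee_fin sqr_ge0.
- apply: emeasurable_funM => //.
  apply: (measurable_inner_sqr mu (g := fun p => residual L a p.2 p.1)).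
  exact: measurable_residual.
- apply: emeasurable_funM => //.
  exact: (measurable_inner_sqr mu mpsi).
- move=> x _; apply: lee_wpmul2r; first by rewrite lee_fin (weight_ge0 st).
  pose psi (y : n.-tuple R) := \sum_i a i x * tnth y i - phi y x.
  have mpsi' : measurable_fun setT psi.
    apply: measurable_funB.
      by apply: measurable_sum => i; apply: measurable_funM => //; exact: measurable_tnth.
    exact: (measurable_fun_pair1 (f := fun p : n.-tuple R * X => phi p.1 p.2)).
  have := uncorrelated_optimal gauss (clf_residual a x cL) cL (aL x) mpsi'.
  congr (_ <= _)%E; apply: eq_integral => f _; congr (EFin (_ ^+ 2)).
  rewrite /psi /residual.
  under [X in _ + (X - _)]eq_bigr do rewrite tnth_mktuple.
  by ring.
Qed.

Lemma Gamma_lin (M : 'I_0 -> F -> R) (a : 'I_0 -> X -> R) :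
  Gamma lam D rho iota mu = lin_error M a.
Proof.
rewrite /Gamma.
have e f : normG2 lam D rho (iota f) = (\int[lam']_x ((val f x) ^+ 2 * w x)%:E)%E.
  rewrite (_ : iota f = fun x => iota f x - 0); last by apply/funext => x; rewrite subr0.
  by rewrite (normG2E st); under eq_integral do rewrite subr0.
under eq_integral do rewrite e.
rewrite (swap_error st (g := fun p => val p.1 p.2)); last exact: (measurable_eval st).
apply: eq_integral => x _; congr (_ * _)%E; apply: eq_integral => f _.
by rewrite /residual big_ord0 subr0.
Qed.

End LinearAlgorithms.

(** * From linear functionals to function values *)

(** Rows are chosen greedily: as long as [N] has fewer than [m] rows, its cokernel has a nonzero
    column [t], and a [v] in [V] with [v *m t != 0] lies outside the row space of [N]. *)
Lemma spanning_rows (K : fieldType) m (V : set 'rV[K]_m) :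
  (forall t : 'cV[K]_m, t != 0 -> exists2 v, V v & v *m t != 0) ->
  exists2 N : 'M[K]_m, (forall i, V (row i N)) & N \in unitmx.
Proof.
move=> Vspan.
have key k : (k <= m)%N -> exists2 N : 'M[K]_(k, m), (forall i, V (row i N)) & row_free N.
  elim: k => [_|k IH km]; first by exists 0 => [[]//|]; rewrite /row_free mxrank0.
  have [N VN freeN] := IH (ltnW km).
  have rkN : \rank N = k by apply/eqP.
  have : cokermx N != 0 by rewrite -mxrank_eq0 mxrank_coker rkN subn_eq0 -ltnNge.
  case/matrix0Pn => i [j cij].
  have t0 : col j (cokermx N) != 0.
    by apply: contraNneq cij => /colP/(_ i); rewrite !mxE => ->.
  have [v Vv vt] := Vspan _ t0.
  have VvN (l : 'I_(1 + k)) : V (row l (col_mx v N)).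
    case: (split_ordP l) => l' ->; [rewrite rowKu|by rewrite rowKd].
    by rewrite ord1 (_ : row 0 v = v)//; apply/rowP => l0; rewrite mxE.
  exists (col_mx v N : 'M[K]_(1 + k, m)); first exact: VvN.
  have ltN : (N < v + N)%MS.
    rewrite ltmxE addsmxSr/=; apply: contra vt => /(submx_trans (addsmxSl _ _)) /submxP[u ->].
    by rewrite colE -mulmxA (mulmxA N) mulmx_coker mul0mx mulmx0.
  have := rank_ltmx ltN; rewrite rkN addsmxE => rk.
  by rewrite /row_free eqn_leq rank_leq_row.
have [N VN freeN] := key m (leqnn m).
by exists N => //; rewrite -row_free_unit.
Qed.

(** Cramer's rule, by expanding the modified determinant along row [j], whose cofactors are those of
    [N]. *)
Lemma cramer_row (K : fieldType) m (N : 'M[K]_m) (v : 'rV[K]_m) j : N \in unitmx ->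
  (v *m invmx N) 0 j = \det (\matrix_(i, k) (if i == j then v 0 k else N i k)) / \det N.
Proof.
move=> uN; rewrite /invmx uN -scalemxAr mxE mulrC; congr (_ * _).
rewrite (expand_det_row _ j) mxE; apply: eq_bigr => k _.
rewrite !mxE eqxx; congr (_ * _); rewrite /cofactor; congr (_ * \det _).
by apply/matrixP => p q; rewrite !mxE eq_sym (negbTE (neq_lift _ _)).
Qed.

Lemma det_norm_le (R : realDomainType) m (N : 'M[R]_m) (B : R) :
  (forall i j, `|N i j| <= B) -> `|\det N| <= (m`!)%:R * B ^+ m.
Proof.
move=> NB; apply: le_trans (ler_norm_sum _ _ _) _.
rewrite (_ : _ * _ = \sum_(s : 'S_m) B ^+ m); last first.
  by rewrite sumr_const card_Sn mulr_natl.
apply: ler_sum => s _; rewrite normrM normrX normrN1 expr1n mul1r normr_prod.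
rewrite -[X in B ^+ X](card_ord m) -prodr_const.
by apply: ler_prod => i _; rewrite normr_ge0 NB.
Qed.

(* Eliminating alpha_{i0} from a pairing of dependent coefficients. *)
Lemma drop_dependent (R : fieldType) m (t al be : 'I_m.+1 -> R) i0 :
  t i0 != 0 -> \sum_i t i * al i = 0 ->
  \sum_j al (lift i0 j) * (- (t (lift i0 j) / t i0) * be i0 + be (lift i0 j)) =
  \sum_i al i * be i.
Proof.
move=> t0; rewrite (bigD1_ord i0)//= => e.
rewrite [RHS](bigD1_ord i0)//=.
under eq_bigr do rewrite mulrDr.
rewrite big_split/=; congr (_ + _).
rewrite (_ : al i0 = - (\sum_i t (lift i0 i) * al (lift i0 i)) / t i0); last first.
  by apply: (mulfI t0); rewrite mulrCA divff// mulr1; apply/eqP; rewrite -addr_eq0 e.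
rewrite -sumrN !mulr_suml; apply: eq_bigr => j _.
by ring.
Qed.

(** * Linear schemes with the fewest terms *)

Section StandardInformation.
Context {R : realType} {d : nat} (lam : {measure set (d.-tuple R) -> \bar R})
  (D : set (d.-tuple R)) (rho : d.-tuple R -> R)
  (F : completeNormedModType R) (iota : F -> d.-tuple R -> R)
  (mu : probability (g_sigma_algebraType (@open F)) R).
Hypothesis st : standing lam D rho iota mu.
Local Notation T := (g_sigma_algebraType (@open F)).
Local Notation X := (d.-tuple R).
Local Notation lam' := (lam_sf st).
Local Notation val := (value D iota).
Local Notation w := (weight D rho).

Let gauss := let: And5 _ _ _ _ g := st in g.

(** The vanishing of the coefficients outside [D] later forces the interpolation points into [D]. *)
Definition linear_scheme m (M : 'I_m -> F -> R) (a : 'I_m -> X -> R) : Prop :=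
  [/\ forall i, clf (M i), forall i, measurable_fun setT (a i) &
      forall i x, ~ D x -> a i x = 0].

Definition realizable (E : R) m : Prop := exists M a,
  @linear_scheme m M a /\ (lin_error st M a <= E%:E)%E.

Lemma lin_error_ae m n (M : 'I_m -> F -> R) a (M' : 'I_n -> F -> R) a' :
  (forall i, clf (M i)) -> (forall i, clf (M' i)) ->
  (forall x, {ae mu, forall f : T, residual D iota M a x f = residual D iota M' a' x f}) ->
  lin_error st M a = lin_error st M' a'.
Proof.
move=> cM cM' h; apply: eq_integral => x _; congr (_ * _)%E.
have mr k (P : 'I_k -> F -> R) b : (forall i, clf (P i)) ->
    measurable_fun setT (fun f : T => ((residual D iota P b x f) ^+ 2)%:E).
  move=> cP; apply/measurable_EFinP; apply: measurable_funX.
  by apply: clf_measurable; exact: (clf_residual st).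
apply: ae_eq_integral => //; [exact: mr|exact: mr|].
by apply: filterS (h x) => f /= -> _.
Qed.

Definition minimal_scheme (E : R) m (M : 'I_m -> F -> R) (a : 'I_m -> X -> R) : Prop :=
  [/\ linear_scheme M a, (lin_error st M a <= E%:E)%E &
      forall k, realizable E k -> (m <= k)%N].

(** A linear relation among the coefficient functions would allow one functional to be absorbed into
    the others without changing the residual, contradicting minimality. *)
Lemma minimal_coefficients_free E m (M : 'I_m -> F -> R) a (t : 'I_m -> R) i :
  minimal_scheme E M a -> t i != 0 -> exists x, \sum_j t j * a j x != 0.
Proof.
move=> minM ti; apply: contrapT => /forallNP h.
have {}h x : \sum_j t j * a j x = 0 by apply/eqP; apply: contrapT => /negP; exact: h.
move: minM t i ti h; case: m M a => [|k] N b; first by move=> _ t [].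
move=> [[cN mb bD] err min] t i ti h.
suff : realizable E k by move/min; rewrite ltnn.
exists (fun j f => - (t (lift i j) / t i) * N i f + N (lift i j) f).
exists (fun j => b (lift i j)); split.
  split => [j|j|j x nDx]; [|exact: mb|exact: bD].
  exact: (clf_lin _ (cN i) (cN (lift i j))).
rewrite (@lin_error_ae _ _ _ _ N b)//; first by move=> j; exact: (clf_lin _ (cN i) (cN (lift i j))).
move=> x; apply: aeW => f; rewrite /residual; congr (_ - _).
exact: (drop_dependent (fun j => N j f) ti (h x)).
Qed.

(** The dual elimination, on the coefficient side. An almost sure relation already preserves the
    error, so a witness exists inside any set [P] of full measure. *)
Lemma minimal_functionals_free E m (M : 'I_m -> F -> R) a (t : 'I_m -> R) i (P : set T) :
  minimal_scheme E M a -> t i != 0 -> {ae mu, forall f : T, P f} ->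
  exists2 f : T, P f & \sum_j t j * M j f != 0.
Proof.
move=> minM ti aeP; apply: contrapT => /forall2NP h.
have {}h f : P f -> \sum_j t j * M j f = 0.
  by move=> Pf; have [//|/negP/negPn/eqP] := h f.
move: minM t i ti h; case: m M a => [|k] N b; first by move=> _ t [].
move=> [[cN mb bD] err min] t i ti h.
suff : realizable E k by move/min; rewrite ltnn.
exists (fun j => N (lift i j)).
exists (fun j x => - (t (lift i j) / t i) * b i x + b (lift i j) x); split.
  split => //.
  - by move=> j; apply: measurable_funD => //; exact: measurable_funM.
  - by move=> j x nDx; rewrite !bD// mulr0 addr0.
rewrite (@lin_error_ae _ _ _ _ N b)// => x.
apply: filterS aeP => f Pf; rewrite /residual; congr (_ - _).
under eq_bigr do rewrite mulrC; under [RHS]eq_bigr do rewrite mulrC.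
exact: (drop_dependent (fun j => b j x) ti (h f Pf)).
Qed.

Definition sqint (g : X -> R) : Prop :=
  measurable_fun setT g /\ (\int[lam']_x ((g x) ^+ 2 * w x)%:E < +oo)%E.

Lemma measurable_sqw (g : X -> R) : measurable_fun setT g ->
  measurable_fun setT (fun x => ((g x) ^+ 2 * w x)%:E).
Proof.
move=> mg; apply/measurable_EFinP; apply: measurable_funM.
  exact: measurable_funX.
exact: (measurable_weight st).
Qed.

Lemma sqw_ge0 (g : X -> R) x : (0 <= ((g x) ^+ 2 * w x)%:E)%E.
Proof. by rewrite lee_fin mulr_ge0 ?sqr_ge0 ?(weight_ge0 st). Qed.

Lemma sqint_lin c g h : sqint g -> sqint h -> sqint (fun x => c * g x + h x).
Proof.
move=> [mg ig] [mh ih]; split.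
  by apply: measurable_funD => //; exact: measurable_funM.
apply: (@le_lt_trans _ _ (\int[lam']_x ((2 * c ^+ 2)%:E * ((g x) ^+ 2 * w x)%:E +
   2%:E * ((h x) ^+ 2 * w x)%:E))%E).
  apply: ge0_le_integral => //.
  - by move=> x _; exact: (sqw_ge0 (fun x => c * g x + h x)).
  - by apply: measurable_sqw; apply: measurable_funD => //; exact: measurable_funM.
  - by apply: emeasurable_funD; apply: emeasurable_funM => //; exact: measurable_sqw.
  - move=> x _; rewrite -!EFinM -EFinD lee_fin !mulrA -mulrDl.
    apply: ler_wpM2r; first exact: (weight_ge0 st).
    by have := sqr_ge0 (c * g x - h x); nra.
have c0 : (0 <= (2 * c ^+ 2)%:E)%E by rewrite lee_fin mulr_ge0 ?sqr_ge0.
rewrite ge0_integralD//.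
- rewrite !ge0_integralZl//; try exact: measurable_sqw; try by move=> x _; exact: sqw_ge0.
  by rewrite lte_add_pinfty// lte_mul_pinfty.
- by move=> x _; rewrite mule_ge0//; exact: sqw_ge0.
- by apply: emeasurable_funM => //; exact: measurable_sqw.
- by move=> x _; rewrite mule_ge0//; exact: sqw_ge0.
- by apply: emeasurable_funM => //; exact: measurable_sqw.
Qed.

Lemma sqint_sum n (c : 'I_n -> R) (g : 'I_n -> X -> R) :
  (forall i, sqint (g i)) -> sqint (fun x => \sum_i c i * g i x).
Proof.
elim: n c g => [|n IH] c g ig.
  split; first by rewrite (_ : (fun x => _) = cst 0)//; apply/funext => x; rewrite big_ord0.
  rewrite integral0_eq// => x _; by rewrite big_ord0 expr0n/= mul0r.
under eq_fun do rewrite big_ord_recl.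
by apply: sqint_lin => //; exact: (IH (fun i => c (lift ord0 i)) (fun i => g (lift ord0 i))).
Qed.

Lemma sqint_value f : sqint (val f).
Proof.
split; first exact: (measurable_value st).
have [_ _ _ [_ [C bound] _] _] := st.
apply: le_lt_trans (ltry (C * `|f| ^+ 2)); apply: le_trans (bound f).
rewrite (_ : iota f = fun x => iota f x - 0); last by apply/funext => x; rewrite subr0.
by rewrite (normG2E st); under [leRHS]eq_integral do rewrite subr0.
Qed.

(* For almost every f the residual is square integrable, hence so is the
   approximation of f; choosing f_1, .., f_m with det (M_i f_k) <> 0 and solving
   for the a_i gives square integrability of each of them. *)
Lemma minimal_coefficients_sqint E m (M : 'I_m -> F -> R) a i :
  minimal_scheme E M a -> sqint (a i).
Proof.
move=> minM; have [[cM ma aD] errE min_m] := minM.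
pose r f := (\int[lam']_x ((residual D iota M a x f) ^+ 2 * w x)%:E)%E.
have mres := measurable_residual st cM ma.
have r_int : mu.-integrable setT (r : T -> \bar R).
  apply/integrableP; split.
    pose h (p : T * X) := ((residual D iota M a p.2 p.1) ^+ 2 * w p.2)%:E.
    have mh : measurable_fun setT h.
      apply/measurable_EFinP; apply: measurable_funM; first exact: measurable_funX.
      by apply: measurableT_comp => //; exact: (measurable_weight st).
    have h0 p : (0 <= h p)%E by exact: (sqw_ge0 (fun x => residual D iota M a x p.1)).
    exact: (measurable_fun_fubini_tonelli_F (m2 := lam') h mh h0).
  under eq_integral => f _.
    rewrite gee0_abs; last first.
      by apply: integral_ge0 => x _; exact: (sqw_ge0 (fun x => residual D iota M a x f)).
    over.
  rewrite (swap_error st (g := fun p => residual D iota M a p.2 p.1))//.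
  by apply: le_lt_trans errE _; rewrite ltry.
have aer := integrable_ae measurableT r_int.
(* Information vectors of those [f] whose residual is square integrable; this holds for almost every
   [f], so no linear form vanishes on [V]. *)
pose V := [set v : 'rV[R]_m | exists f : T, (setT f -> r f \is a fin_num) /\ v = \row_j M j f].
have [N VN uN] : exists2 N : 'M[R]_m, (forall i, V (row i N)) & N \in unitmx.
  apply: spanning_rows => t t0.
  have [k [l tk]] : exists k l, t k l != 0 by exact/matrix0Pn.
  have tk0 : t k 0 != 0 by rewrite -(ord1 l).
  have [f rf sf] := minimal_functionals_free (t := fun k => t k 0) minM tk0 aer.
  exists (\row_j M j f); first by exists f.
  apply: contraNneq sf => /matrixP/(_ 0 0); rewrite mxE [RHS]mxE => vt0.
  apply/eqP; rewrite -[RHS]vt0.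
  by apply: eq_bigr => j _; rewrite mxE mulrC.
have [fs hfs] := choice VN.
pose u k x := \sum_j a j x * M j (fs k).
have iu k : sqint (u k).
  have [rk _] := hfs k.
  have ires : sqint (fun x => residual D iota M a x (fs k)).
    split; first exact: (measurable_fun_pair2 (f := fun p : T * X => residual D iota M a p.2 p.1) (fs k) mres).
    by rewrite ltey_eq rk.
  have := sqint_lin (-1) ires (sqint_value (fs k)).
  congr sqint; apply/funext => x; rewrite /u /residual; ring.
have aE x : a i x = \sum_k invmx N i k * u k x.
  have : \col_j a j x = invmx N *m \col_k u k x.
    rewrite -[LHS](mulKmx uN); congr (_ *m _); apply/colP => k; rewrite !mxE.
    apply: eq_bigr => j _; rewrite mxE mulrC; congr (_ * _).
    have [_ /rowP/(_ j)] := hfs k; by rewrite !mxE.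
  by move=> /colP/(_ i); rewrite !mxE => ->; apply: eq_bigr => k _; rewrite mxE.
by rewrite (_ : a i = fun x => \sum_k invmx N i k * u k x); [exact: sqint_sum|exact/funext].
Qed.

End StandardInformation.

(** * Interpolation at nearly optimal points *)

Section InterpolationPoints.
Context {R : realType} {d : nat} (lam : {measure set (d.-tuple R) -> \bar R})
  (D : set (d.-tuple R)) (rho : d.-tuple R -> R)
  (F : completeNormedModType R) (iota : F -> d.-tuple R -> R)
  (mu : probability (g_sigma_algebraType (@open F)) R).
Hypothesis st : standing lam D rho iota mu.
Local Notation T := (g_sigma_algebraType (@open F)).
Local Notation X := (d.-tuple R).
Local Notation lam' := (lam_sf st).
Local Notation val := (value D iota).
Local Notation w := (weight D rho).

Let gauss := let: And5 _ _ _ _ g := st in g.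

Lemma cov_scale c L : clf L -> cov mu (fun f => c * L f) (fun f => c * L f) = c ^+ 2 * cov mu L L.
Proof.
move=> cL; have := cov_lin_sqr gauss c cL (clf0 F).
under [X in cov mu X _]eq_fun do rewrite addr0.
under [X in cov mu _ X]eq_fun do rewrite addr0.
by rewrite !cov0 mulr0 !addr0.
Qed.

Lemma cov_add_le L M : clf L -> clf M ->
  cov mu (fun f => L f + M f) (fun f => L f + M f) <= 2 * cov mu L L + 2 * cov mu M M.
Proof.
move=> cL cM.
have := cov_ge0 mu (fun f => -1 * L f + M f); rewrite (cov_lin_sqr gauss)//.
rewrite (_ : (fun f => L f + M f) = fun f => 1 * L f + M f).
  by rewrite (cov_lin_sqr gauss)//; lra.
by apply/funext => f; rewrite mul1r.
Qed.

(** The Cauchy-Schwarz bound for a sum of arbitrary, possibly correlated functionals. *)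
Lemma cov_sum_le n (L : 'I_n -> F -> R) : (forall i, clf (L i)) ->
  cov mu (fun f => \sum_i L i f) (fun f => \sum_i L i f) <= n%:R * \sum_i cov mu (L i) (L i).
Proof.
have sumE k (N : 'I_k -> F -> R) : (forall i, clf (N i)) -> clf (fun f => \sum_i N i f).
  move=> cN; have := clf_sum (fun=> 1) cN; congr clf; apply/funext => f.
  by apply: eq_bigr => i _; rewrite mul1r.
elim: n L => [|n IH] L cL.
  rewrite (_ : (fun f => _) = fun=> 0); last by apply/funext => f; rewrite big_ord0.
  by rewrite cov0 mul0r.
pose S f := \sum_(i < n) L (lift ord0 i) f; pose Q := \sum_(i < n) cov mu (L (lift ord0 i)) (L (lift ord0 i)).
have cS : clf S by exact: sumE.
have {}IH : cov mu S S <= n%:R * Q by exact: IH.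
rewrite (_ : (fun f => _) = fun f => 1 * L ord0 f + S f); last first.
  by apply/funext => f; rewrite big_ord_recl mul1r.
rewrite big_ord_recl -/Q (cov_lin_sqr gauss)//.
(* This weight gives [2 n cov(L_0, S) <= n^2 var L_0 + var S], which closes the induction after
   multiplication by [n]; hence [n = 0] is treated apart. *)
have := cov_ge0 mu (fun f => - n%:R * L ord0 f + S f); rewrite (cov_lin_sqr gauss)//.
have Q0 : 0 <= Q by apply: sumr_ge0 => i _; exact: cov_ge0.
have V0 := cov_ge0 mu (L ord0); have S0 := cov_ge0 mu S.
case: (posnP n) => [n0|n0 h].
  have S00 : cov mu S S = 0 by apply/eqP; rewrite eq_le S0 andbT (le_trans IH)// n0 mul0r.
  have SL : cov mu (L ord0) S = 0 by exact: (cov_degenerate st).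
  have nz : n%:R = 0 :> R by rewrite n0.
  by move=> _; rewrite S00 SL -(natr1 n) nz expr1n !mulr0 add0r !mul1r !addr0 lerDl.
have n0' : 0 < n%:R :> R by rewrite ltr0n.
rewrite -(ler_pM2l n0') -natr1.
move: h n0' IH; set N := n%:R; set c := cov mu (L ord0) S => h N0 IH.
have := ler_wpM2l (ltW N0) IH; nra.
Qed.

Section Interpolation.
Variables (E : R) (m : nat) (M : 'I_m -> F -> R) (a : 'I_m -> X -> R).
Hypotheses (E0 : 0 < E) (minM : minimal_scheme st E M a).

Let cM : forall i, clf (M i). Proof. by case: minM => -[]. Qed.
Let ma : forall i, measurable_fun setT (a i). Proof. by case: minM => -[]. Qed.
Let aD : forall i x, ~ D x -> a i x = 0. Proof. by case: minM => -[]. Qed.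

Let Z := residual D iota M a.
Let cZ x : clf (Z x). Proof. exact: (clf_residual st). Qed.
Let V x : R := cov mu (Z x) (Z x).
Let A x : R := \sum_i (a i x) ^+ 2.

Let A0 x : 0 <= A x. Proof. by apply: sumr_ge0 => i _; exact: sqr_ge0. Qed.

Lemma coefficient_le_sum_sqr i x : (a i x) ^+ 2 <= A x.
Proof. by rewrite /A (bigD1 i)//= lerDl sumr_ge0// => j _; exact: sqr_ge0. Qed.

Section Fekete.
Variable eta : R.
Hypothesis eta0 : 0 < eta.

(** The term with [eta] ensures that [g] vanishes only where all [a i] do, and that the quotients
    [a i / g] are bounded. *)
Let g x : R := Num.sqrt (V x + eta * A x).

Let g0 x : 0 <= g x. Proof. exact: sqrtr_ge0. Qed.

Let gE x : (g x) ^+ 2 = V x + eta * A x.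
Proof. by rewrite sqr_sqrtr// addr_ge0 ?cov_ge0// mulr_ge0 ?A0// ltW. Qed.

Let a_g x : g x = 0 -> forall i, a i x = 0.
Proof.
move=> gx i; have := gE x; rewrite gx expr0n/= => e.
have : eta * A x <= 0 by have := cov_ge0 mu (Z x); rewrite -/(V x) => ?; lra.
rewrite pmulr_rle0// => /(le_trans (coefficient_le_sum_sqr i x)).
by move=> ai; apply/eqP; rewrite -sqrf_eq0 eq_le ai sqr_ge0.
Qed.

Let nrow x : 'rV[R]_m := \row_i (a i x / g x).
Let nmat (P : 'I_m -> X) : 'M[R]_m := \matrix_(j, i) (a i (P j) / g (P j)).

Let nmat_bound P i j : `|nmat P i j| <= Num.sqrt eta^-1.
Proof.
rewrite mxE; have [gx|gx] := eqVneq (g (P i)) 0.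
  by rewrite gx invr0 mulr0 normr0 sqrtr_ge0.
rewrite -sqrtr_sqr ler_wsqrtr// exprMn exprVn gE.
have gpos : 0 < V (P i) + eta * A (P i) by rewrite -gE exprn_gt0// lt_neqAle eq_sym gx g0.
rewrite ler_pdivrMr// ler_pdivlMl//.
have := coefficient_le_sum_sqr j (P i); have := cov_ge0 mu (Z (P i)); rewrite -/(V _).
by move=> V0 h; rewrite (le_trans (ler_wpM2l (ltW eta0) h))// lerDr.
Qed.

(* Fekete points for the system a_i / g, up to a factor two since the maximum
   need not be attained; Cramer's rule then bounds the interpolation weights. *)
Lemma interpolation_weights : exists (P : 'I_m -> X) (W : 'I_m -> X -> R),
  [/\ forall j, D (P j), forall j, measurable_fun setT (W j),
      forall x i, \sum_j W j x * a i (P j) = a i x &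
      forall j x, (W j x) ^+ 2 * V (P j) <= 4 * (V x + eta * A x)].
Proof.
have [P0 uP0] : exists P0, nmat P0 \in unitmx.
  pose B := [set v : 'rV[R]_m | exists x, v = nrow x].
  have [N BN uN] : exists2 N : 'M[R]_m, (forall i, B (row i N)) & N \in unitmx.
    apply: spanning_rows => t t0.
    have [k [l tk]] : exists k l, t k l != 0 by exact/matrix0Pn.
    have tk0 : t k 0 != 0 by rewrite -(ord1 l).
    have [x sx] := minimal_coefficients_free (t := fun k => t k 0) minM tk0.
    have gx : g x != 0.
      apply: contraNneq sx => gx; rewrite big1// => j _.
      by rewrite a_g// mulr0.
    exists (nrow x); first by exists x.
    apply: contraNneq sx => /matrixP/(_ 0 0); rewrite mxE [RHS]mxE => vt0.
    apply/eqP; apply: (mulIf (invr_neq0 gx)); rewrite mul0r -[RHS]vt0 mulr_suml.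
    by apply: eq_bigr => j _; rewrite mxE; ring.
  have [P0 hP0] := choice BN; exists P0.
  rewrite (_ : nmat P0 = N)//; apply/matrixP => j i.
  by have /rowP/(_ i) := hP0 j; rewrite !mxE => ->.
pose Delta P : R := `|\det (nmat P)|.
pose S : set R := [set y | exists P, y = Delta P].
(* This bound grows as [eta] tends to 0, but it serves only to make the supremum finite; the factor
   2 below is independent of [eta]. *)
have hS : has_sup S.
  split; first by exists (Delta P0), P0.
  exists (m`!%:R * Num.sqrt eta^-1 ^+ m) => _ [P ->].
  by apply: det_norm_le => i j; exact: nmat_bound.
have DP0 : 0 < Delta P0 by rewrite normr_gt0 -unitfE -unitmxE.
have supS : 0 < sup S.
  by apply: lt_le_trans DP0 _; apply: sup_upper_bound => //; exists P0.
have [_ [P ->] DP] : exists2 y, S y & sup S / 2 < y.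
  have s2 : 0 < sup S / 2 by rewrite divr_gt0.
  have [y Sy] := sup_adherent s2 hS.
  by move=> h; exists y => //; apply: le_lt_trans h; lra.
have DP1 : 0 < Delta P by apply: lt_trans DP; rewrite divr_gt0.
have uP : nmat P \in unitmx by rewrite unitmxE unitfE -normr_gt0.
have gP j : g (P j) != 0.
  apply: contraTneq uP => gj; rewrite unitmxE unitfE negbK (expand_det_row _ j) big1// => i _.
  by rewrite mxE gj invr0 mulr0 mul0r.
have gP0 j : 0 < g (P j) by rewrite lt_neqAle eq_sym gP g0.
pose ell x := nrow x *m invmx (nmat P).
have ell2 x j : `|ell x 0 j| <= 2.
  rewrite /ell cramer_row// normrM normfV ler_pdivrMr//.
  (* The numerator in Cramer's rule is the determinant with the [j]-th point replaced by [x], at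
     most [sup S], whereas the denominator exceeds [sup S / 2]. *)
  rewrite (_ : \matrix_(_, _) _ = nmat (fun i => if i == j then x else P i)).
    apply: (@le_trans _ _ (sup S)); first by apply: sup_upper_bound => //; eexists.
    by rewrite -/(Delta P); lra.
  by apply/matrixP => p q; rewrite !mxE; case: ifP.
(* Equal to [ell x 0 j * g x / g (P j)], but in this form measurability in [x] follows from that of
   the [a i]. *)
pose W j x := (\sum_i a i x * invmx (nmat P) i j) / g (P j).
have WE j x : W j x = ell x 0 j * g x / g (P j).
  rewrite /W /ell mxE; congr (_ / _); rewrite mulr_suml; apply: eq_bigr => i _.
  rewrite mxE; have [gx|gx] := eqVneq (g x) 0; first by rewrite (a_g gx) !mul0r.
  by field.
exists P, W; split.
(* A point outside [D] would give a zero row in the invertible matrix [nmat P]. *)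
- move=> j; apply: contrapT => nD; have := gP j; apply/negP; rewrite negbK.
  apply: contraTT uP => _; rewrite unitmxE unitfE negbK (expand_det_row _ j) big1// => i _.
  by rewrite mxE aD// !mul0r.
- move=> j; apply: measurable_funM => //.
  by apply: measurable_sum => i; apply: measurable_funM.
- move=> x i.
  have := mulmxKV uP (nrow x) => /rowP/(_ i); rewrite mxE [RHS]mxE => e.
  have [gx|gx] := eqVneq (g x) 0.
    by rewrite (a_g gx) big1// => j _; rewrite WE gx mulr0 !mul0r.
  apply: (mulIf (invr_neq0 gx)); rewrite -e mulr_suml; apply: eq_bigr => j _.
  by rewrite WE [nmat _ _ _]mxE -/(ell x); field; rewrite gx gP.
- move=> j x; rewrite WE -gE.
  have -> : (ell x 0 j * g x / g (P j)) ^+ 2 * V (P j) =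
      (ell x 0 j) ^+ 2 * (V (P j) / (g (P j)) ^+ 2) * (g x) ^+ 2 by field.
  apply: ler_wpM2r; first exact: sqr_ge0.
  have h1 : (ell x 0 j) ^+ 2 <= 4.
    by have := ell2 x j; rewrite ler_norml => /andP[? ?]; nra.
  have h2 : V (P j) / g (P j) ^+ 2 <= 1.
    by rewrite ler_pdivrMr ?exprn_gt0// mul1r gE lerDl mulr_ge0 ?A0// ltW.
  rewrite -[leRHS]mulr1 ler_pM ?sqr_ge0// mulr_ge0 ?cov_ge0// invr_ge0 sqr_ge0//.
Qed.

End Fekete.

(** Interpolation reproduces the [a i] exactly, so the projection cancels from the error and only
    the residual at [x] and the weighted residuals at the points remain. *)
Lemma standard_algorithm : exists (P : 'I_m -> X) (phi : m.-tuple R -> X -> R),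
  [/\ forall j, D (P j), measurable_alg phi &
    (err2 lam D rho iota mu (fun j f => iota f (P j)) phi <=
      (18 * (m.+1%:R) ^+ 2 * E)%:E)%E].
Proof.
pose I i := (\int[lam']_x ((a i x) ^+ 2 * w x)%:E)%E.
have I_fin i : I i \is a fin_num.
  rewrite ge0_fin_numE; first by have [] := minimal_coefficients_sqint i minM.
  by apply: integral_ge0 => x _; exact: (sqw_ge0 st).
have I0 i : 0 <= fine (I i).
  by rewrite fine_ge0//; apply: integral_ge0 => x _; exact: (sqw_ge0 st).
pose B := \sum_i fine (I i).
have B0 : 0 <= B by apply: sumr_ge0 => i _; exact: I0.
(* [B] is the weighted integral of [A], so the [eta] term integrates to at most [E]; adding 1 keeps
   the denominator positive. *)
pose eta := E / (B + 1).
have B1 : 0 < B + 1 by rewrite ltr_wpDl.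
have eta0 : 0 < eta by rewrite divr_gt0.
have mw : measurable_fun setT (fun x => (w x)%:E).
  by apply/measurable_EFinP; exact: (measurable_weight st).
have mA : measurable_fun setT A by apply: measurable_sum => i; exact: measurable_funX.
have mV : measurable_fun setT V.
  apply/measurable_EFinP; rewrite (_ : _ \o _ = fun x => \int[mu]_f ((Z x f) ^+ 2)%:E)%E.
    apply: (measurable_inner_sqr mu (g := fun p => Z p.2 p.1)).
    exact: (measurable_residual st).
  by apply/funext => x; rewrite (cov_sqr gauss (cZ x)).
have intA : (\int[lam']_x (A x * w x)%:E = B%:E)%E.
  under eq_integral do rewrite /A mulr_suml -sumEFin.
  rewrite ge0_integral_sum//; last by move=> i x _; exact: (sqw_ge0 st).
    by rewrite /B -sumEFin; apply: eq_bigr => i _; rewrite fineK.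
  by move=> i; exact: (measurable_sqw st).
have intV : (\int[lam']_x (V x * w x)%:E <= E%:E)%E.
  case: minM => _ errE _; apply: le_trans errE; rewrite /lin_error.
  rewrite le_eqVlt; apply/orP; left; apply/eqP; apply: eq_integral => x _.
  by rewrite EFinM (cov_sqr gauss (cZ x)).
have [P [W [PD mW Wa WV]]] := interpolation_weights eta0.
pose phi (y : m.-tuple R) x := \sum_j W j x * tnth y j.
have cP j : clf (fun f => iota f (P j)).
  have := clf_value st (P j); congr clf; apply/funext => f.
  by rewrite /value patchE mem_set.
have mphi : measurable_alg phi.
  apply: measurable_sum => j; apply: measurable_funM.
    exact: (measurableT_comp (mW j) (@measurable_snd _ _ (m.-tuple R) X)).
  exact: (measurableT_comp (measurable_tnth j) (@measurable_fst _ _ (m.-tuple R) X)).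
exists P, phi; split => //; rewrite (err2E st)//.
(* From [2 V + 2 m] times a sum of [m] terms, each at most [4 (V + eta A)]. After integration the
   total is at most [(2 + 16 m^2) E]. *)
pose c1 : R := 2 + 8 * m%:R ^+ 2; pose c2 := 8 * m%:R ^+ 2 * eta.
have c10 : 0 <= c1 by rewrite addr_ge0// mulr_ge0// sqr_ge0.
have c20 : 0 <= c2 by rewrite mulr_ge0 ?(ltW eta0)// mulr_ge0// sqr_ge0.
apply: (@le_trans _ _ (\int[lam']_x (c1%:E * (V x * w x)%:E + c2%:E * (A x * w x)%:E))%E).
  have e x : (\int[mu]_f ((val f x - phi (info (fun j f => iota f (P j)) f) x) ^+ 2)%:E =
     (cov mu (fun f => Z x f + \sum_j - W j x * Z (P j) f)
             (fun f => Z x f + \sum_j - W j x * Z (P j) f))%:E)%E.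
    rewrite -(cov_sqr gauss).
      apply: eq_integral => f _; congr (EFin (_ ^+ 2)).
      rewrite /phi /Z /residual.
      under eq_bigr do rewrite tnth_mktuple.
      under [X in _ = _ + X]eq_bigr do rewrite mulNr.
      rewrite sumrN -addrA; congr (_ + _).
      under [X in _ = _ - X]eq_bigr do rewrite mulrBr.
      rewrite sumrB opprB addrA [X in _ = X - _](_ : _ = 0).
        rewrite sub0r; congr (- _); apply: eq_bigr => j _.
        by rewrite /value patchE mem_set.
      apply/eqP; rewrite addrC subr_eq0; apply/eqP.
      under eq_bigr do rewrite mulr_sumr.
      rewrite exchange_big/=; apply: eq_bigr => i _.
      by rewrite -Wa mulr_suml; apply: eq_bigr => j _; rewrite mulrA.
    have := clf_lin 1 (cZ x) (clf_sum (fun j => - W j x) (fun j => cZ (P j))).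
    by congr clf; apply/funext => f; rewrite mul1r.
  apply: ge0_le_integral => //.
  - move=> x _; rewrite e -EFinM lee_fin mulr_ge0 ?cov_ge0//; exact: (weight_ge0 st).
  - apply: emeasurable_funM => //.
    apply: (measurable_inner_sqr mu
      (g := fun p => val p.1 p.2 - phi (info (fun j f => iota f (P j)) p.1) p.2)).
    apply: measurable_funB; first exact: (measurable_eval st).
    apply: (measurableT_comp (f := fun p : m.-tuple R * X => phi p.1 p.2)
      (g := fun p : T * X => (info (fun j f => iota f (P j)) p.1, p.2))) => //.
    apply: measurable_fun_pair => //.
    exact: (measurableT_comp (measurable_info cP)).
  - by apply: emeasurable_funD; apply: emeasurable_funM => //;
      apply/measurable_EFinP; apply: measurable_funM => //; exact: (measurable_weight st).
  - move=> x _; rewrite e -!EFinM -EFinD lee_fin !mulrA -mulrDl.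
    apply: ler_wpM2r; first exact: (weight_ge0 st).
    apply: le_trans (cov_add_le (cZ x) (clf_sum (fun j => - W j x) (fun j => cZ (P j)))) _.
    have cWZ j : clf (fun f => - W j x * Z (P j) f) by exact: clfZ.
    have := cov_sum_le cWZ.
    under eq_bigr do rewrite cov_scale// sqrrN.
    have : \sum_j W j x ^+ 2 * cov mu (Z (P j)) (Z (P j)) <= \sum_(j < m) 4 * (V x + eta * A x).
      by apply: ler_sum => j _; exact: WV.
    rewrite sumr_const card_ord -[X in _ <= X -> _]mulr_natl => h1 h2.
    have m0 : 0 <= m%:R :> R by [].
    have := ler_wpM2l m0 h1 => /(le_trans h2) h3.
    rewrite -/(V x) /c1 /c2; nra.
have mVw : measurable_fun setT (fun x => (V x * w x)%:E).
  by apply/measurable_EFinP; apply: measurable_funM => //; exact: (measurable_weight st).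
have mAw : measurable_fun setT (fun x => (A x * w x)%:E).
  by apply/measurable_EFinP; apply: measurable_funM => //; exact: (measurable_weight st).
have V0 x : (0 <= (V x * w x)%:E)%E by rewrite lee_fin mulr_ge0 ?cov_ge0 ?(weight_ge0 st).
have Aw0 x : (0 <= (A x * w x)%:E)%E by rewrite lee_fin mulr_ge0 ?A0 ?(weight_ge0 st).
rewrite ge0_integralD//; last 4 first.
- by move=> x _; rewrite mule_ge0.
- exact: emeasurable_funM.
- by move=> x _; rewrite mule_ge0.
- exact: emeasurable_funM.
rewrite !ge0_integralZl// intA.
apply: (@le_trans _ _ (c1%:E * E%:E + c2%:E * B%:E)%E).
  by rewrite leeD2r// lee_wpmul2l.
rewrite -!EFinM -EFinD lee_fin.
have etaB : eta * B <= E.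
  by rewrite /eta mulrAC ler_pdivrMr// ler_pM2l// lerDl.
rewrite /c1 /c2 -[X in _ + X]mulrA -natr1.
have m0 : 0 <= m%:R :> R by [].
have h : 8 * m%:R ^+ 2 * (eta * B) <= 8 * m%:R ^+ 2 * E.
  by rewrite ler_wpM2l// mulr_ge0// sqr_ge0.
have : 0 <= m%:R * E by rewrite mulr_ge0// ltW.
nra.
Qed.

End Interpolation.
End InterpolationPoints.

(** * Tractability *)

Section InformationComplexity.
Context {R : realType} {d : nat} (lam : {measure set (d.-tuple R) -> \bar R})
  (D : set (d.-tuple R)) (rho : d.-tuple R -> R)
  (F : completeNormedModType R) (iota : F -> d.-tuple R -> R)
  (mu : probability (g_sigma_algebraType (@open F)) R).
Hypothesis st : standing lam D rho iota mu.
Local Notation eavg := (eavg lam D rho iota mu).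
Local Notation ncomp := (ncomp lam D rho iota mu).

Lemma sqrte_le_EFin (x : \bar R) (r : R) : 0 <= r ->
  (sqrte x <= r%:E)%E = (x <= (r ^+ 2)%:E)%E.
Proof.
move=> r0; rewrite -[RHS]lee_sqrt ?lee_fin ?sqr_ge0//.
by rewrite /= sqrtr_sqr ger0_norm.
Qed.

Lemma err2_ge0 n (L : 'I_n -> F -> R) phi : (0 <= err2 lam D rho iota mu L phi)%E.
Proof.
apply: integral_ge0 => f _; apply: integral_ge0 => x Dx.
by rewrite lee_fin mulr_ge0 ?sqr_ge0//; case: st => _ [_ r0 _] _ _ _; exact: r0.
Qed.

Lemma eavg_all_le_std n : (eavg Lall n <= eavg Lstd n)%E.
Proof.
case: n => [|n] //=; rewrite lee_sqrt.
  apply: le_ereal_inf => _ [L [phi [cL mphi ->]]]; exists L, phi; split => // i.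
  have [x Dx ->] := cL i.
  have := clf_value st x; congr clf; apply/funext => f.
  by rewrite /value patchE mem_set.
by apply: le_ereal_inf_tmp => _ [L [phi [_ _ ->]]]; exact: err2_ge0.
Qed.

(** A minimal scheme for a slightly larger error has [m <= n] terms and is converted by
    [standard_algorithm]. *)
Lemma eavg_std_le_all n e : 0 < e -> (eavg Lall n <= e%:E)%E ->
  exists2 m, (m <= n)%N & (eavg Lstd m <= (6 * n.+1%:R * e)%:E)%E.
Proof.
(* The factor 2 gives slack because the infimum need not be attained; then [18 * 2 = 6 ^ 2] explains
   the constant. *)
move=> e0 en; pose E := 2 * e ^+ 2.
have e2 : 0 < e ^+ 2 by rewrite exprn_gt0.
have E0 : 0 < E by rewrite mulr_gt0.
have rn : realizable st E n.
  case: n en => [|n]; rewrite /= sqrte_le_EFin ?(ltW e0)// => en.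
    exists (fun=> fun=> 0), (fun=> fun=> 0); split; first by split => -[].
    by rewrite -Gamma_lin (le_trans en)// lee_fin /E; lra.
  have /ereal_inf_lt[_ [L [phi [cL mphi ->]]] Le] :
      (ereal_inf [set e | exists (L : 'I_n.+1 -> F -> R)
                            (phi : n.+1.-tuple R -> d.-tuple R -> R),
                      [/\ forall i, in_class D iota Lall (L i), measurable_alg phi &
                        e = err2 lam D rho iota mu L phi]] < E%:E)%E.
    by apply: le_lt_trans en _; rewrite lte_fin /E; lra.
  have [a [ma aD ale]] := linear_algorithm_optimal st cL mphi.
  by exists L, a; split => //; exact: le_trans ale (ltW Le).
have exm : exists k, `[< realizable st E k >] by exists n; exact/asboolP.
case: (ex_minnP exm) => m /asboolP[M [a [sch err]]] min.
have minM : minimal_scheme st E M a.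
  by split => // k rk; apply: min; exact/asboolP.
have mn : (m <= n)%N by apply: min; exact/asboolP.
exists m => //.
have r0 : 0 <= 6 * n.+1%:R * e by rewrite mulr_ge0 ?mulr_ge0// ltW.
have n1 : 1 <= n.+1%:R :> R by rewrite ler1n.
case: m M a {min} sch err minM mn => [|m] M a sch err minM mn;
    rewrite /= sqrte_le_EFin//.
  rewrite (Gamma_lin st M a) (le_trans err)// lee_fin /E !exprMn.
  have : 1 <= n.+1%:R ^+ 2 :> R by rewrite exprn_ege1.
  by nra.
have [P [phi [PD mphi perr]]] := standard_algorithm E0 minM.
apply: (@le_trans _ _ (err2 lam D rho iota mu (fun j f => iota f (P j)) phi)).
  apply: ereal_inf_lbound; exists (fun j f => iota f (P j)), phi; split => //.
  by move=> j; exists (P j).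
apply: le_trans perr _; rewrite lee_fin /E !exprMn.
have : m.+2%:R ^+ 2 <= n.+1%:R ^+ 2 :> R by rewrite lerXn2r ?nnegrE// ler_nat.
by move=> h; have := ler_wpM2r (ltW e2) h; lra.
Qed.

Lemma ncomp_all_le_std crit eps : (ncomp Lall crit eps <= ncomp Lstd crit eps)%E.
Proof.
apply: le_ereal_inf => _ [n /= en <-]; exists n => //=.
by apply: le_trans en; exact: eavg_all_le_std.
Qed.

(** Otherwise every admissible [n] would exceed [B], hence be at least the integer
    [(Num.truncn B).+1], and the infimum would exceed [B]. *)
Lemma ncomp_le_ex c crit eps (B : R) : 0 <= B -> (ncomp c crit eps <= B%:E)%E ->
  exists2 n : nat, n%:R <= B &
    (eavg c n <= eps%:E * CRI lam D rho iota mu crit)%E.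
Proof.
move=> B0 nB; apply: contrapT => /forall2NP h.
have : ((Num.truncn B).+1%:R%:E <= ncomp c crit eps)%E.
  apply: le_ereal_inf_tmp => _ [n /= en <-]; rewrite lee_fin ler_nat.
  have [/negP|//] := h n; rewrite -ltNge => Bn.
  by rewrite truncn_lt_nat.
move=> /le_trans /(_ nB); rewrite lee_fin leNgt truncnS_gt//.
Qed.

Lemma ncomp_le_nat c crit eps (B : R) n : n%:R <= B ->
  (eavg c n <= eps%:E * CRI lam D rho iota mu crit)%E -> (ncomp c crit eps <= B%:E)%E.
Proof.
move=> nB en; apply: (@le_trans _ _ n%:R%:E); last by rewrite lee_fin.
by apply: ereal_inf_lbound; exists n.
Qed.

Lemma ncomp_std_le crit eps eps' (B : R) : 0 < eps -> 0 < eps' -> 0 <= B ->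
  6 * (B + 1) * eps' <= eps -> (ncomp Lall crit eps' <= B%:E)%E ->
  (ncomp Lstd crit eps <= B%:E)%E.
Proof.
move=> e0 e'0 B0 ee' /(ncomp_le_ex B0)[n nB en].
have real (r : R) : 0 < r -> CRI lam D rho iota mu crit = r%:E ->
    (ncomp Lstd crit eps <= B%:E)%E.
  move=> r0 cr; rewrite cr -EFinM in en.
  have [m mn em] := eavg_std_le_all (mulr_gt0 e'0 r0) en.
  apply: (@ncomp_le_nat _ _ _ _ m); first by rewrite (le_trans _ nB)// ler_nat.
  rewrite cr -EFinM (le_trans em)// lee_fin mulrA ler_pM2r//.
  apply: le_trans ee'; rewrite ler_pM2r// ler_pM2l// -natr1.
  by rewrite lerD2r.
case: crit real en => [real _|real _]; first exact: (real 1).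
(* Under [NOR] with initial error 0 or [+oo], the zero algorithm already meets the criterion. *)
have zero : (eavg Lstd 0 <= eps%:E * CRI lam D rho iota mu NOR)%E ->
    (ncomp Lstd NOR eps <= B%:E)%E by exact: ncomp_le_nat.
rewrite /CRI /= in real zero; have := sqrte_ge0 (Gamma lam D rho iota mu).
case: (sqrte _) real zero => [r| |] real zero //.
- rewrite lee_fin le_eqVlt => /orP[/eqP r0|r0]; last exact: (real r).
  by apply: zero; rewrite -r0 mule0.
- by move=> _; apply: zero; rewrite gt0_muley ?lte_fin.
Qed.

End InformationComplexity.

Section LogPowers.
Context {R : realType}.

(** With [r = p + 1] and [v = u^-1], the inequality [ln z <= z - 1] at [z = v^(1/r)] gives
    [1 + ln v <= r v^(1/r)]; its [r]-th power is [r^r v]. *)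
Lemma log_power_bound (p : R) : 0 <= p -> exists2 c : R, 0 < c &
  forall u : R, 0 < u <= 1 -> (1 + ln u^-1) `^ p * u <= c.
Proof.
move=> p0; pose r := p + 1; have r0 : 0 < r by rewrite ltr_wpDl.
exists (r `^ r) => [|u /andP[u0 u1]]; first exact: powR_gt0.
have v1 : 1 <= u^-1 by rewrite invf_ge1.
have lv0 : 0 <= ln u^-1 by exact: ln_ge0.
have iu0 : 0 < u^-1 by rewrite invr_gt0.
pose z := u^-1 `^ r^-1.
have z0 : 0 < z by exact: powR_gt0.
have lz : r^-1 * ln u^-1 <= z - 1.
  have := @le_ln1Dx R (z - 1); rewrite (_ : 1 + (z - 1) = z); last by ring.
  by rewrite ln_powR; apply; lra.
have h : 1 + ln u^-1 <= r * z.
  have := ler_wpM2l (ltW r0) lz; rewrite mulrA divff ?gt_eqF// mul1r.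
  by rewrite /r; lra.
rewrite -ler_pdivlMr//; apply: (@le_trans _ _ ((1 + ln u^-1) `^ r)).
  by apply: ler_powR; [rewrite lerDl|rewrite /r lerDl].
apply: (@le_trans _ _ ((r * z) `^ r)).
  apply: ge0_ler_powR => //; rewrite ?nnegrE; [exact: ltW|exact: addr_ge0|].
  by rewrite ltW// mulr_gt0.
have zr : z `^ r = u^-1.
  by rewrite -powRrM mulVf ?gt_eqF// powRr1//; exact: ltW.
by rewrite powRM ?(ltW r0) ?(ltW z0)// zr.
Qed.

End LogPowers.

(** * Transfer of tractability bounds between the two classes *)

Section Family.
Context {R : realType}
  (lam : forall d : nat, {measure set (d.-tuple R) -> \bar R})
  (D : forall d : nat, set (d.-tuple R))
  (rho : forall d : nat, d.-tuple R -> R)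
  (F : nat -> completeNormedModType R)
  (iota : forall d : nat, F d -> d.-tuple R -> R)
  (mu : forall d : nat, probability (g_sigma_algebraType (@open (F d))) R).
Hypothesis st : standing_all lam D rho F iota mu.
Local Notation ncompF := (ncompF lam D rho F iota mu).

(* Evaluating the bound for Lambda^all at eps' = u^2, u = eps / (K d^q), leaves
   room for the factor 6 (n + 1), because (1 + ln u^-1)^p u is bounded; passing
   from eps to eps' multiplies 1 + ln eps^-1 by at most O(d^q). *)
Lemma std_bound crit (C p q : R) : 0 < C -> 0 <= p -> 0 <= q ->
  (forall (d : nat) (eps : R), (0 < d)%N -> 0 < eps < 1 ->
    (ncompF Lall crit eps d <= (C * (d%:R `^ q) * (1 + ln eps^-1) `^ p)%:E)%E) ->
  exists2 C' : R, 0 < C' & forall (d : nat) (eps : R), (0 < d)%N -> 0 < eps < 1 ->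
    (ncompF Lstd crit eps d <=
      (C' * (d%:R `^ (q + q * p)) * (1 + ln eps^-1) `^ p)%:E)%E.
Proof.
move=> C0 p0 q0 bound; have [c c0 hc] := log_power_bound p0.
pose C1 := C + 1; have C1g : 1 <= C1 by rewrite lerDr ltW.
have C10 : 0 < C1 by lra.
have tp0 : 0 < 2 `^ p :> R by exact: powR_gt0.
(* Chosen so that [12 B u^2 <= K Q u = eps] below; adding 1 makes [ln K] nonnegative. *)
pose K := 12 * C1 * 2 `^ p * c + 1.
have Kc : 0 < 12 * C1 * 2 `^ p * c by rewrite !mulr_gt0.
have K1 : 1 <= K by rewrite lerDr ltW.
have K0 : 0 < K by lra.
have lK : 0 <= ln K by exact: ln_ge0.
exists (C1 * 2 `^ p * (2 + ln K) `^ p).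
  by rewrite !mulr_gt0// powR_gt0//; lra.
move=> d eps d0 /andP[e0 e1].
pose Q : R := d%:R `^ q.
have Q1 : 1 <= Q by rewrite -[leLHS](powRr0 d%:R) ler_powR// ler1n.
have Q0 : 0 < Q by lra.
have lQ : 0 <= ln Q by exact: ln_ge0.
have KQ0 : 0 < K * Q by rewrite mulr_gt0.
have KQ1 : 1 <= K * Q by nra.
pose u := eps / (K * Q).
have u0 : 0 < u by rewrite divr_gt0.
have u1 : u < 1 by rewrite ltr_pdivrMr// mul1r; lra.
have le0 : 0 <= ln eps^-1 by apply: ln_ge0; rewrite invf_ge1// ltW.
have luE : ln u^-1 = ln K + ln Q + ln eps^-1.
  by rewrite /u invf_div lnM ?lnM// ?posrE// invr_gt0.
have lu0 : 0 <= ln u^-1 by rewrite luE !addr_ge0.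
have u2 : 0 < u ^+ 2 < 1.
  by rewrite exprn_gt0//= expr2; nra.
have lu2 : ln (u ^+ 2)^-1 = 2 * ln u^-1.
  by rewrite -exprVn lnXn ?invr_gt0// mulr_natl.
(* The factor [2 ^ p] comes from [1 + 2 ln u^-1 <= 2 (1 + ln u^-1)]. Since [C1 >= 1], also [B >= 1],
   whence [B + 1 <= 2 B]. *)
pose B := C1 * Q * (2 `^ p * (1 + ln u^-1) `^ p).
have lup1 : 1 <= (1 + ln u^-1) `^ p.
  by rewrite -[leLHS](powRr0 (1 + ln u^-1)) ler_powR// lerDl.
have tp1 : 1 <= 2 `^ p :> R by rewrite -[leLHS](powRr0 2) ler_powR// ler1n.
have B1 : 1 <= B.
  rewrite /B -[leLHS]mulr1 ler_pM//.
    by rewrite -[leLHS]mulr1 ler_pM.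
  by rewrite -[leLHS]mulr1 ler_pM.
have Bu : 6 * (B + 1) * u ^+ 2 <= eps.
  apply: (@le_trans _ _ (12 * B * u ^+ 2)).
    by apply: ler_wpM2r; [exact: sqr_ge0|lra].
  have -> : 12 * B * u ^+ 2 =
      12 * C1 * 2 `^ p * ((1 + ln u^-1) `^ p * u) * (Q * u) by rewrite /B; ring.
  have hu := hc u; rewrite u0 (ltW u1) in hu; have {}hu := hu isT.
  have Qu0 : 0 <= Q * u by rewrite mulr_ge0// ltW.
  apply: (@le_trans _ _ (12 * C1 * 2 `^ p * c * (Q * u))).
    apply: ler_wpM2r => //; apply: ler_wpM2l => //.
    by rewrite !mulr_ge0// ltW.
  apply: (@le_trans _ _ (K * (Q * u))); first by rewrite ler_wpM2r// lerDl.
  rewrite le_eqVlt; apply/orP; left; apply/eqP; rewrite /u; field.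
  by rewrite !gt_eqF.
have allB : (ncompF Lall crit (u ^+ 2) d <= B%:E)%E.
  apply: le_trans (bound d _ d0 u2) _; rewrite lee_fin lu2 /B.
  rewrite -powRM//; last by rewrite addr_ge0.
  apply: ler_pM; rewrite ?powR_ge0//; first by rewrite mulr_ge0 ?powR_ge0// ltW.
    by rewrite ler_wpM2r ?powR_ge0// lerDl.
  apply: ge0_ler_powR => //; rewrite ?nnegrE.
  - by rewrite addr_ge0// mulr_ge0.
  - by rewrite mulr_ge0// addr_ge0.
  - lra.
have e0' : 0 < u ^+ 2 by rewrite exprn_gt0.
have B0 : 0 <= B by lra.
apply: le_trans (ncomp_std_le (st d0) e0 e0' B0 Bu allB) _.
rewrite lee_fin.
have hl : 1 + ln u^-1 <= (2 + ln K) * Q * (1 + ln eps^-1).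
  (* This crude bound puts a factor [Q] inside the power [p] and so accounts for the extra exponent
     [q * p] of [d]; the exponent [p] of the logarithm is unchanged. *)
  have lQQ : ln Q <= Q by rewrite ltW// ln_sublinear.
  have h1 : 1 + ln K + ln Q <= (2 + ln K) * Q by nra.
  rewrite luE; set y := ln eps^-1 in le0 *; set x := (2 + ln K) * Q in h1 *.
  have x1 : 1 <= x by lra.
  by nra.
rewrite powRD; last by rewrite pnatr_eq0 -lt0n d0 implybT.
rewrite powRrM -/Q.
have -> : C1 * 2 `^ p * (2 + ln K) `^ p * (Q * Q `^ p) * (1 + ln eps^-1) `^ p =
    C1 * Q * (2 `^ p * ((2 + ln K) * Q * (1 + ln eps^-1)) `^ p).
  have K2 : 0 <= 2 + ln K by lra.
  have e2 : 0 <= 1 + ln eps^-1 by lra.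
  rewrite powRM// ?mulr_ge0// ?(ltW Q0)// powRM// ?(ltW Q0)//; ring.
rewrite /B ler_wpM2l ?mulr_ge0 ?(ltW C10) ?(ltW Q0)// ler_wpM2l ?(ltW tp0)//.
apply: ge0_ler_powR => //; rewrite ?nnegrE; first by rewrite addr_ge0.
by rewrite (le_trans _ hl)// addr_ge0.
Qed.

Lemma EXP_PT_std crit : EXP_PT lam D rho F iota mu Lall crit ->
  EXP_PT lam D rho F iota mu Lstd crit.
Proof.
move=> [C [p [q [C0 p0 q0 bound]]]].
have [C' C'0 bound'] := std_bound C0 p0 q0 bound.
by exists C', p, (q + q * p); split => //; rewrite addr_ge0// mulr_ge0.
Qed.

Lemma EXP_PT_all crit : EXP_PT lam D rho F iota mu Lstd crit ->
  EXP_PT lam D rho F iota mu Lall crit.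
Proof.
move=> [C [p [q [C0 p0 q0 bound]]]]; exists C, p, q; split => // d eps d0 he.
exact: le_trans (ncomp_all_le_std (st d0) _ _) (bound d eps d0 he).
Qed.

(** The case [q = 0], in which the new exponent [q + q * p] of [d] is again 0 and [p] is
    preserved. *)
Lemma SPT_bound_std crit (C p : R) : 0 < C -> 0 <= p ->
  SPT_bound lam D rho F iota mu Lall crit C p ->
  exists2 C', 0 < C' & SPT_bound lam D rho F iota mu Lstd crit C' p.
Proof.
move=> C0 p0 bound.
have [|C' C'0 bound'] := @std_bound crit C p 0 C0 p0 (lexx 0).
  by move=> d eps d0 he; rewrite powRr0 mulr1; exact: bound.
exists C' => // d eps d0 he; have := bound' d eps d0 he.
by rewrite mul0r addr0 powRr0 mulr1.
Qed.

Lemma SPT_bound_all crit (C p : R) :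
  SPT_bound lam D rho F iota mu Lstd crit C p ->
  SPT_bound lam D rho F iota mu Lall crit C p.
Proof.
move=> bound d eps d0 he.
exact: le_trans (ncomp_all_le_std (st d0) _ _) (bound d eps d0 he).
Qed.

Lemma EXP_SPT_std crit : EXP_SPT lam D rho F iota mu Lall crit ->
  EXP_SPT lam D rho F iota mu Lstd crit.
Proof.
move=> [C [p [C0 p0 /(SPT_bound_std C0 p0)[C' C'0 bound]]]].
by exists C', p; split.
Qed.

Lemma EXP_SPT_all crit : EXP_SPT lam D rho F iota mu Lstd crit ->
  EXP_SPT lam D rho F iota mu Lall crit.
Proof. by move=> [C [p [C0 p0 /SPT_bound_all bound]]]; exists C, p; split. Qed.

(** The two sets of admissible exponents coincide, not merely their infima. *)
Lemma EXP_p_all_std crit :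
  EXP_p lam D rho F iota mu Lall crit = EXP_p lam D rho F iota mu Lstd crit.
Proof.
have e : [set p : R | 0 <= p /\ exists C : R, 0 < C /\
      SPT_bound lam D rho F iota mu Lall crit C p] =
    [set p : R | 0 <= p /\ exists C : R, 0 < C /\
      SPT_bound lam D rho F iota mu Lstd crit C p].
  apply/seteqP; split=> p [p0 [C [C0 bound]]].
    by have [C' C'0 bound'] := SPT_bound_std C0 p0 bound; split => //; exists C'.
  by split => //; exists C; split => //; exact: SPT_bound_all.
by rewrite /EXP_p e.
Qed.

End Family.

Theorem theorem5p2 (R : realType)
  (lam : forall d : nat, {measure set (d.-tuple R) -> \bar R})
  (D : forall d : nat, set (d.-tuple R))
  (rho : forall d : nat, d.-tuple R -> R)
  (F : nat -> completeNormedModType R)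
  (iota : forall d : nat, F d -> d.-tuple R -> R)
  (mu : forall d : nat, probability (g_sigma_algebraType (@open (F d))) R) :
  standing_all lam D rho F iota mu ->
  ((EXP_PT lam D rho F iota mu Lall ABS <-> EXP_PT lam D rho F iota mu Lstd ABS) /\
   (EXP_SPT lam D rho F iota mu Lall ABS <-> EXP_SPT lam D rho F iota mu Lstd ABS)) /\
  (forall crit : err_crit,
     EXP_SPT lam D rho F iota mu Lall crit ->
     EXP_SPT lam D rho F iota mu Lstd crit /\
     EXP_p lam D rho F iota mu Lall crit = EXP_p lam D rho F iota mu Lstd crit).
Proof.
move=> st; split; first split.
- by split; [exact: EXP_PT_std|exact: EXP_PT_all].
- by split; [exact: EXP_SPT_std|exact: EXP_SPT_all].
- by move=> crit spt; split; [exact: EXP_SPT_std|exact: EXP_p_all_std].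
Qed.
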